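(* Let $n\geq 1$, let $c$ be a standard Coxeter element of the symmetric group $\mathfrak{S}_{n+1}$ and let $x\in \mathrm{NC}(\mathfrak{S}_{n+1},c)$. Then the permutation $S_c(x)\in\mathfrak{S}_{n+1}$ constructed from the ordered polygons of $x$ (see context) is $c$-sortable and $\mathsf{Read}(S_c(x))=x$. That is, the map $x\mapsto S_c(x)$ is $\mathsf{Read}^{-1}$, the inverse of Reading's bijection $\mathsf{Read}:\mathrm{Sort}_c(\mathfrak{S}_{n+1})\to\mathrm{NC}(\mathfrak{S}_{n+1},c)$.
   Context: General notions. $(W,S)$ is a finite Coxeter system, $T$ its set of reflections, $\ell,\ell_T$ the length functions with respect to $S$ and $T$; a standard Coxeter element $c$ is a product of all elements of $S$, each once, in some order; $u\leq_T v$ iff $\ell_T(u)+\ell_T(u^{-1}v)=\ell_T(v)$; $\mathrm{NC}(W,c)=\{x\in W:x\leq_T c\}$; $N(w)=\{t\in T:\ell(tw)<\ell(w)\}$. Fix a reduced expression $s_1\cdots s_n$ of $c$ and let $c^\infty=s_1\cdots s_n|s_1\cdots s_n|\cdots$. The $c$-sorting word of $w$ is the lexicographically first (as a sequence of positions) $S$-reduced expression of $w$ appearing as a subword of $c^\infty$; write it $w_1w_2\cdots w_k$ with $w_i$ the part from the $i$-th copy of $c$ ($k$ maximal with $w_k$ nonempty), regarded also as a subset of $S$. Then $w$ is $c$-sortable if $w_k\subseteq\cdots\subseteq w_1$; $\mathrm{Sort}_c(W)$ is the set of $c$-sortable elements. For $w$ $c$-sortable with $c$-sorting word $s_{i_1}\cdots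 s_{i_\ell}$, order $N(w)$ so that its $j$-th element is $s_{i_1}\cdots s_{i_{j-1}}s_{i_j}s_{i_{j-1}}\cdots s_{i_1}$; let $t_1,\dots,t_k$ be the elements of $\mathrm{Cov}(w)=\{wsw^{-1}:s\in S,\ell(ws)<\ell(w)\}$ listed in this order; $\mathsf{Read}(w)=t_1\cdots t_k$. By Reading, $\mathsf{Read}$ is a bijection $\mathrm{Sort}_c(W)\to\mathrm{NC}(W,c)$. Type $A_n$. $W=\mathfrak{S}_{n+1}$, $S=\{s_1,\dots,s_n\}$ with $s_i=(i,i+1)$; permutations are composed from right to left. A standard Coxeter element $c$ is an $(n+1)$-cycle $(i_1,\dots,i_{n+1})$ with $i_1=1$, $i_k=n+1$, where $i_1i_2\cdots i_k$ is increasing and $i_k\cdots i_{n+1}$ is decreasing. Put $R_c=\{i_1,\dots,i_k\}$, $L_c=\{i_k,\dots,i_{n+1},i_1\}$. Label points on a circle clockwise by $i_1,i_2,\dots,i_{n+1}$, placed so that point $i$ is higher than point $j$ whenever $i<j$, with $1$ at the top, $n+1$ at the bottom, the other points of $R_c$ on the right and the other points of $L_c$ on the left. Each $x\in\mathrm{NC}(\mathfrak{S}_{n+1},c)$ is represented by the polygons which are the convex hulls of the supports of the cycles of $x$ (fixed points included, giving one-point polygons; two-element cycles give segments); these polygons are pairwise disjoint. $\mathrm{Pol}(x)$ is the set of these polygons, each identified with its set of vertex labels. Relative positions. For distinct $P,Q\in\mathrm{Pol}(x)$, $P$ is strictly at the left of $Q$ (and $Q$ strictly at the right of $P$) if some horizontal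 line $L$ meets both and $L\cap P$ is to the left of $L\cap Q$ (this does not depend on $L$). Total order $\prec$ on $\mathrm{Pol}(x)$. The first polygon is the unique polygon $P$ such that no polygon lies strictly at the right of $P$ and $\max(P)$ is minimal among polygons with this property. Remove $P$ and its vertices; the second polygon is chosen in the same way among the remaining polygons, and so on. The permutation $S_c(x)$. If the polygons in increasing order for $\prec$ are $P=\{d_1>d_2>\dots>d_k\}$, $Q=\{e_1>e_2>\dots>e_\ell\}$, etc., then $S_c(x)$ is defined by $1\mapsto d_1,\dots,k\mapsto d_k$, $k+1\mapsto e_1,\dots,k+\ell\mapsto e_\ell$, and so on; i.e. the line notation of $S_c(x)$ lists the polygons in the order $\prec$, each written in decreasing order. *)

(* Defs.v *)
From HB Require Import structures.
From mathcomp Require Import all_boot all_order all_fingroup all_algebra.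
From mathcomp Require Import boolp.
From mathcomp Require classical_sets.

Set Implicit Arguments.
Unset Strict Implicit.
Unset Printing Implicit Defensive.

Import Order.TTheory GRing.Theory Num.Theory.

(* The labels 1, ..., n+1 are encoded as 0, ..., n, i.e. as 'I_n.+1.  MathComp
   composes permutations from left to right; [pmul] is the product from right
   to left. *)
Definition pmul m (u v : 'S_m) : 'S_m := (v * u)%g.

Lemma pmulE m (u v : 'S_m) i : pmul u v i = u (v i).
Proof. exact: permM. Qed.

Definition wprod m (s : seq 'S_m) : 'S_m := foldr (@pmul m) 1%g s.

Definition pconj m (w t : 'S_m) : 'S_m := pmul (pmul w t) w^-1%g.

Definition simple_refl n (i : 'I_n) : 'S_n.+1 :=
  tperm (widen_ord (leqnSn n) i) (lift ord0 i).

Definition simples n : {set 'S_n.+1} := [set simple_refl i | i : 'I_n].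

Definition reflections n : {set 'S_n.+1} :=
  [set pconj w s | w in [set: 'S_n.+1], s in simples n].

(* The least length of a word in A with product w; a shortest word for an
   element of the group generated by A has fewer letters than the group has
   elements, as its prefixes have distinct products. *)
Definition word_length m (A : {set 'S_m}) (w : 'S_m) : nat :=
  find (fun k => [exists s : k.-tuple 'S_m,
                    all (fun t => t \in A) s && (wprod s == w)])
       (iota 0 #|{: 'S_m}|).

Definition ellS n (w : 'S_n.+1) := word_length (simples n) w.
Definition ellT n (w : 'S_n.+1) := word_length (reflections n) w.

Definition leT n (u v : 'S_n.+1) : bool :=
  ellT u + ellT (pmul u^-1%g v) == ellT v.

Definition NC n (c : 'S_n.+1) : {set 'S_n.+1} := [set x | leT x c].

Definition standard_coxeter n (c : 'S_n.+1) : Prop :=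
  exists2 s : seq 'S_n.+1, perm_eq s (enum (simples n)) & c = wprod s.

Definition reduced_word n (s : seq 'S_n.+1) (w : 'S_n.+1) : Prop :=
  [/\ {subset s <= simples n}, wprod s = w & size s = ellS w].

Section Sortable.

Variables (n : nat) (cw : seq 'S_n.+1).

(* Positions in c^oo are counted from 0; cw is a reduced word of c. *)
Definition letter_at (p : nat) : 'S_n.+1 := nth 1%g cw (p %% size cw).

Definition subword_at (p : seq nat) : seq 'S_n.+1 := map letter_at p.

Definition reduced_positions (w : 'S_n.+1) (p : seq nat) : Prop :=
  sorted ltn p /\ reduced_word (subword_at p) w.

Definition sorting_positions_spec (w : 'S_n.+1) (p : seq nat) : Prop :=
  reduced_positions w p /\
  (forall q, reduced_positions w q -> ((p : seqlexi nat) <= q)%O).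

(* Such a sequence exists and is unique when cw is a reduced word of a standard
   Coxeter element; the default [::] is used only for other cw. *)
Definition sorting_positions (w : 'S_n.+1) : seq nat :=
  classical_sets.xget [::] (sorting_positions_spec w).

Definition sorting_word (w : 'S_n.+1) : seq 'S_n.+1 :=
  subword_at (sorting_positions w).

(* The part of the sorting word in the copy number i of c, counted from 0. *)
Definition sorting_block (w : 'S_n.+1) (i : nat) : seq 'S_n.+1 :=
  subword_at [seq p <- sorting_positions w | p %/ size cw == i].

(* The blocks after the last nonempty one satisfy the inclusion trivially. *)
Definition sortable (w : 'S_n.+1) : Prop :=
  forall i, {subset sorting_block w i.+1 <= sorting_block w i}.

Definition Cov (w : 'S_n.+1) : {set 'S_n.+1} :=
  [set pconj w s | s in simples n & ellS (pmul w s) < ellS w].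

Definition inversion_seq (u : seq 'S_n.+1) : seq 'S_n.+1 :=
  [seq pconj (wprod (take j u)) (nth 1%g u j) | j <- iota 0 (size u)].

Definition Read (w : 'S_n.+1) : 'S_n.+1 :=
  wprod [seq t <- inversion_seq (sorting_word w) | t \in Cov w].

End Sortable.

(* The sequence i_1, ..., i_{n+1} with c = (i_1, ..., i_{n+1}) and i_1 = 1. *)
Definition cycle_seq n (c : 'S_n.+1) : seq 'I_n.+1 := traject c ord0 n.+1.

Definition Rc n (c : 'S_n.+1) : seq 'I_n.+1 :=
  take (index ord_max (cycle_seq c)).+1 (cycle_seq c).

Definition Lc n (c : 'S_n.+1) : seq 'I_n.+1 :=
  rcons (drop (index ord_max (cycle_seq c)) (cycle_seq c)) ord0.

Definition Pol n (x : 'S_n.+1) : {set {set 'I_n.+1}} := porbits x.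

Section Geometry.

Local Open Scope ring_scope.

Variables (R : realFieldType) (n : nat).

(* The points i_1, ..., i_{n+1} are then met in this order when going clockwise
   around the circle from its top: down along Rc, then up along Lc. *)
Definition circle_placement (c : 'S_n.+1) (pt : 'I_n.+1 -> R * R) : Prop :=
  exists (o : R * R) (r : R),
    [/\ 0 < r,
        forall i, ((pt i).1 - o.1) ^+ 2 + ((pt i).2 - o.2) ^+ 2 = r ^+ 2,
        pt ord0 = (o.1, o.2 + r) /\ pt ord_max = (o.1, o.2 - r),
        forall i j : 'I_n.+1, (i < j)%N -> (pt j).2 < (pt i).2 &
        forall i, i != ord0 -> i != ord_max ->
          (i \in Rc c -> o.1 < (pt i).1) /\ (i \in Lc c -> (pt i).1 < o.1)].

Variable pt : 'I_n.+1 -> R * R.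

Definition in_hull (P : {set 'I_n.+1}) (z : R * R) : Prop :=
  exists a : 'I_n.+1 -> R,
    [/\ forall i, i \in P -> 0 <= a i, \sum_(i in P) a i = 1,
        z.1 = \sum_(i in P) a i * (pt i).1 &
        z.2 = \sum_(i in P) a i * (pt i).2].

(* The line is the set of points with ordinate h. *)
Definition strictly_left (P Q : {set 'I_n.+1}) : Prop :=
  exists h : R,
    [/\ exists z, in_hull P z /\ z.2 = h,
        exists z, in_hull Q z /\ z.2 = h &
        forall z z', in_hull P z -> z.2 = h -> in_hull Q z' -> z'.2 = h ->
          z.1 < z'.1].

Definition right_free (D : {set {set 'I_n.+1}}) (P : {set 'I_n.+1}) : bool :=
  [forall Q in D, (Q != P) ==> ~~ `[< strictly_left P Q >]].

Definition max_label (P : {set 'I_n.+1}) : nat := (\max_(i in P) i)%N.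

Definition is_first (D : {set {set 'I_n.+1}}) (P : {set 'I_n.+1}) : bool :=
  [&& P \in D, right_free D P &
      [forall Q in D, right_free D Q ==> (max_label P <= max_label Q)%N]].

Fixpoint prec_enum_rec (k : nat) (D : {set {set 'I_n.+1}}) :
    seq {set 'I_n.+1} :=
  if k is k'.+1 then
    if [pick P | is_first D P] is Some P then P :: prec_enum_rec k' (D :\ P)
    else [::]
  else [::].

Definition prec_enum (D : {set {set 'I_n.+1}}) : seq {set 'I_n.+1} :=
  prec_enum_rec #|D| D.

Definition decreasing_enum (P : {set 'I_n.+1}) : seq 'I_n.+1 :=
  sort (fun i j : 'I_n.+1 => (j <= i)%N) (enum P).

Definition line_notation (x : 'S_n.+1) : seq 'I_n.+1 :=
  flatten [seq decreasing_enum P | P <- prec_enum (Pol x)].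

(* The default value 1 of [insubd] is for a line notation that is not a
   permutation, which does not occur for a noncrossing x. *)
Definition Sc (x : 'S_n.+1) : 'S_n.+1 :=
  insubd (1%g : 'S_n.+1) [ffun i : 'I_n.+1 => nth ord0 (line_notation x) i].

End Geometry.

(* Main.v *)
(* A permutation is c-sortable exactly when it is aligned: for labels i < j < k
   with k before i in line notation, j comes before i if j is on the right side
   of the circle and after k if j is on the left side.  This is proved along the
   greedy reading of c^oo, which produces the sorting word: a letter that is
   skipped leaves the list of usable letters, one that is used moves to its end,
   and both moves preserve alignment.  The same induction shows that
   for labels i < j < k with (i j) and (j k) inversions, (i j) comes first in
   the order of the sorting word if j is on the right, and (j k) comes first if
   j is on the left.  Hence Read w is the permutation whose cycles are the
   descending runs of w, each turned clockwise; the same computation for the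
   single run n+1 > ... > 1 describes c.

   NC(c) consists of the permutations with clockwise noncrossing cycles, since
   going down from c in the absolute order splits one cycle at each step.  For
   such an x the line notation of S_c(x) is aligned, and its descending runs are
   the polygons of x, so Read (S_c(x)) = x.  Conversely the runs of an aligned w
   are noncrossing, and an aligned permutation is determined by its runs. *)
Require Import Defs.
From HB Require Import structures.
From mathcomp Require Import all_boot all_order all_fingroup all_algebra.
From mathcomp Require Import boolp.
From mathcomp Require Import zify ring lra.

Set Implicit Arguments.
Unset Strict Implicit.
Unset Printing Implicit Defensive.
Import Order.TTheory GRing.Theory Num.Theory.

(** * Words, inversions and lengths *)

(** The list of usable letters changes at each step of the greedy reading, so alignment is stated
    for an arbitrary word [u] and not just for a word of [c]. Rotating a letter [a] from front to
    back exchanges the sides of the labels [a] and [a.+1], which is just what multiplication by that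
    letter does to the labels: this is why using a letter preserves alignment. Clockwise order is
    made arithmetic by giving the label [p] the key [p] on the right and [n.*2 - p] on the left, so
    that claims about arcs become linear inequalities. Conjugation by [w] turns the cover
    reflections into distinct adjacent transpositions of positions, so one lemma on products of such
    transpositions serves both for [c], on labels, and for [Read w], on positions. Metric geometry
    enters in one place only: [strictly_left] is replaced by [left_of], which compares the highest
    and lowest vertices of two polygons and looks at the side of one highest vertex. *)

Definition adj_tperm n (a : nat) : 'S_n.+1 := tperm (inord a) (inord a.+1).

Definition adj_swap (a v : nat) : nat := if v == a then a.+1 else if v == a.+1 then a else v.

(* The place of the label v in the line notation of w. *)
Definition pos n (w : 'S_n.+1) (v : nat) : nat := w^-1%g (inord v).

Definition desc n (w : 'S_n.+1) (a : nat) : bool := pos w a.+1 < pos w a.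

Definition lmul n (a : nat) (w : 'S_n.+1) : 'S_n.+1 := pmul (adj_tperm n a) w.

Definition Inv n (w : 'S_n.+1) : {set 'I_n.+1 * 'I_n.+1} :=
  [set p : 'I_n.+1 * 'I_n.+1 | (p.1 < p.2) && (pos w p.2 < pos w p.1)].

Lemma adj_swapK a : involutive (adj_swap a).
Proof. move=> v; rewrite /adj_swap; do ! case: eqP => //; lia. Qed.

Lemma adj_swapP a v : v = a /\ adj_swap a v = a.+1 \/ v = a.+1 /\ adj_swap a v = a \/
  v <> a /\ v <> a.+1 /\ adj_swap a v = v.
Proof.
rewrite /adj_swap; case: eqP => [->|va]; first by left.
by case: eqP => [->|va1]; right; [left | right].
Qed.

Lemma adj_swap_le n a v : a < n -> v <= n -> adj_swap a v <= n.
Proof. rewrite /adj_swap; do ! case: eqP => //; lia. Qed.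

Lemma adj_tperm_inord n a v : a < n -> v <= n -> adj_tperm n a (inord v) = inord (adj_swap a v).
Proof.
move=> an vn; rewrite /adj_tperm /adj_swap.
case: (eqVneq v a) => [->|va]; first by rewrite tpermL.
case: (eqVneq v a.+1) => [->|va1]; first by rewrite tpermR.
rewrite tpermD //; apply/eqP => /(congr1 val) /=; rewrite !inordK; lia.
Qed.

Lemma adj_tperm_val n a (v : 'I_n.+1) : a < n -> adj_tperm n a v = adj_swap a v :> nat.
Proof.
move=> an; rewrite -{1}(inord_val v) adj_tperm_inord ?leq_ord // inordK //.
by rewrite ltnS adj_swap_le ?leq_ord.
Qed.

Lemma adj_tpermK n a : (adj_tperm n a * adj_tperm n a)%g = 1%g.
Proof. exact: tperm2. Qed.

Lemma lmulK n a : involutive (@lmul n a).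
Proof. by move=> w; rewrite /lmul /pmul -mulgA adj_tpermK mulg1. Qed.

Lemma adj_tperm_simples n a : a < n -> adj_tperm n a \in simples n.
Proof.
move=> an; apply/imsetP; exists (Ordinal an) => //; rewrite /adj_tperm /simple_refl.
by congr tperm; apply: val_inj; rewrite /= inordK //; lia.
Qed.

Lemma simplesP n (t : 'S_n.+1) : reflect (exists2 a, a < n & t = adj_tperm n a) (t \in simples n).
Proof.
apply: (iffP idP) => [/imsetP [i _ ->]|[a an ->]]; last exact: adj_tperm_simples.
exists i => //; rewrite /adj_tperm /simple_refl.
by congr tperm; apply: val_inj; rewrite /= ?bump0 inordK //; have := ltn_ord i; lia.
Qed.

Lemma pos_le n (w : 'S_n.+1) v : pos w v <= n.
Proof. by rewrite /pos -ltnS ltn_ord. Qed.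

Lemma pos_inj n (w : 'S_n.+1) u v : u <= n -> v <= n -> pos w u = pos w v -> u = v.
Proof.
by move=> un vn /val_inj /perm_inj /(congr1 val); rewrite /= !inordK.
Qed.

Lemma pos_lmul n a (w : 'S_n.+1) v : a < n -> v <= n -> pos (lmul a w) v = pos w (adj_swap a v).
Proof.
by move=> an vn; rewrite /pos /lmul /pmul invMg permM tpermV adj_tperm_inord.
Qed.

Lemma pos1 n v : v <= n -> pos (1%g : 'S_n.+1) v = v.
Proof. by move=> vn; rewrite /pos invg1 perm1 inordK. Qed.

Lemma pos_ord n (w : 'S_n.+1) (i : 'I_n.+1) : pos w i = w^-1%g i.
Proof. by rewrite /pos inord_val. Qed.

Lemma pos_perm n (w : 'S_n.+1) (p : 'I_n.+1) : pos w (w p) = p.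
Proof. by rewrite pos_ord permK. Qed.

Lemma descE n (w : 'S_n.+1) a : a < n -> ~~ desc w a = (pos w a < pos w a.+1).
Proof.
move=> an; rewrite /desc -leqNgt leq_eqVlt; case: eqP => //= e.
by have := pos_inj (ltnW an) an e; lia.
Qed.

Lemma desc_lmul n (w : 'S_n.+1) a : a < n -> desc (lmul a w) a = ~~ desc w a.
Proof.
move=> an; rewrite descE // /desc !pos_lmul //; last exact: ltnW.
by rewrite /adj_swap !eqxx; have -> : (a.+1 == a) = false by lia.
Qed.

(** Exchanging the labels [a] and [a.+1] keeps the order of every other pair of labels, so the
    inversions of [w] are carried along injectively; the pair of [a] and [a.+1] is the one added. *)
Lemma Inv_lmul n (w : 'S_n.+1) a : a < n -> ~~ desc w a ->
  #|Inv (lmul a w)| = #|Inv w|.+1.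
Proof.
move=> an; rewrite descE // => h.
pose f (p : 'I_n.+1 * 'I_n.+1) := (adj_tperm n a p.1, adj_tperm n a p.2).
have fK : involutive f by case=> x y; rewrite /f /= !tpermK.
have -> : Inv (lmul a w) = (inord a, inord a.+1) |: f @: Inv w.
  apply/setP => p; rewrite !inE.
  have -> : (p \in f @: Inv w) = (f p \in Inv w).
    by rewrite -{1}(fK p) mem_imset //; exact: inv_inj.
  rewrite inE /f /= !adj_tperm_val // !pos_lmul ?leq_ord //.
  case: p => i k /=; rewrite xpair_eqE -!val_eqE /= !inordK; try lia.
  have := ltn_ord i; have := ltn_ord k.
  by case: (adj_swapP a i) => [[-> ->]|[[-> ->]|[? [? ->]]]];
    case: (adj_swapP a k) => [[-> ->]|[[-> ->]|[? [? ->]]]]; try lia.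
rewrite cardsU1 card_imset; last exact: inv_inj.
case: imsetP => [[[i k]]|_]; last by rewrite add1n.
rewrite inE /= => /andP [ik hk] [/(congr1 val) /=].
rewrite adj_tperm_val // => e1 /(congr1 val) /=; rewrite adj_tperm_val // => e2.
move: e1 e2 ik hk; have := ltn_ord i; have := ltn_ord k; rewrite !inordK; try lia.
by case: (adj_swapP a i) => [[-> ->]|[[-> ->]|[? [? ->]]]];
  case: (adj_swapP a k) => [[-> ->]|[[-> ->]|[? [? ->]]]]; lia.
Qed.

Lemma Inv_lmul_desc n (w : 'S_n.+1) a : a < n -> desc w a ->
  #|Inv w| = #|Inv (lmul a w)|.+1.
Proof.
by move=> an h; rewrite -{1}(lmulK a w) Inv_lmul // desc_lmul // h.
Qed.

Lemma nodesc_eq1 n (w : 'S_n.+1) : (forall a, a < n -> ~~ desc w a) -> w = 1%g.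
Proof.
move=> h.
have lo v : v <= n -> v <= pos w v.
  elim: v => // v IH vn; have := h v vn; rewrite descE //; have := IH (ltnW vn); lia.
have hi v : v <= n -> pos w (n - v) <= n - v.
  elim: v => [|v IH] vn; first by have := pos_le w (n - 0); lia.
  have := h (n - v.+1); rewrite descE; last by lia.
  have -> : (n - v.+1).+1 = n - v by lia.
  by have := IH (ltnW vn); lia.
suff e : w^-1%g = 1%g by rewrite -(invgK w) e invg1.
apply/permP => i; rewrite perm1; apply: val_inj; change (w^-1%g i = i :> nat); rewrite -pos_ord.
have := ltn_ord i; have := lo i; have := hi (n - i).
have -> : n - (n - i) = i by have := ltn_ord i; lia.
by lia.
Qed.

Lemma Inv1 n : #|Inv (1%g : 'S_n.+1)| = 0.
Proof.
apply/eqP; rewrite cards_eq0; apply/eqP/setP => [[i k]]; rewrite !inE /=.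
by rewrite !pos1 ?leq_ord //; lia.
Qed.

Lemma desc_exists n (w : 'S_n.+1) : w != 1%g -> exists2 a, a < n & desc w a.
Proof.
move=> w1; apply: contrapT => h; case/negP: w1; apply/eqP/nodesc_eq1 => a an.
by apply/negP => d; apply: h; exists a.
Qed.

(** Length is measured by inversions, so that reducedness can be used by induction before [ellS] is
    known to count them. *)
Definition reduced_idx n (v : seq nat) (w : 'S_n.+1) : Prop :=
  [/\ all (fun a => a < n) v, wprod (map (adj_tperm n) v) = w & size v = #|Inv w|].

Lemma wprod_cons m (t : 'S_m) s : wprod (t :: s) = pmul t (wprod s).
Proof. by []. Qed.

Lemma Inv_wprod n v : all (fun a => a < n) v -> #|Inv (wprod (map (adj_tperm n) v))| <= size v.
Proof.
elim: v => [|a v IH] /=; first by rewrite Inv1.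
move=> /andP [an hv]; rewrite -/(lmul a _).
have := IH hv; case: (boolP (desc (wprod (map (adj_tperm n) v)) a)) => d.
  by move=> le; rewrite -ltnS -(Inv_lmul_desc an d) (leq_trans le) //; lia.
by rewrite Inv_lmul.
Qed.

Lemma reduced_idx_cons n a v (w : 'S_n.+1) :
  reduced_idx (a :: v) w <-> [/\ a < n, desc w a & reduced_idx v (lmul a w)].
Proof.
split=> [[/= /andP [an hv] e /= sz]|[an d [hv e sz]]].
  have e' : wprod (map (adj_tperm n) v) = lmul a w by rewrite -e -/(lmul a _) lmulK.
  have le := Inv_wprod hv; rewrite e' in le.
  have d : desc w a.
    by apply: contraT => d; move: le; rewrite (Inv_lmul an d) -sz; lia.
  by split=> //; split=> //; apply: succn_inj; rewrite sz (Inv_lmul_desc an d).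
split=> /=; first by rewrite an.
  by rewrite e -/(lmul a _) lmulK.
by rewrite sz -(Inv_lmul_desc an d).
Qed.

Lemma reduced_idx_exists n (w : 'S_n.+1) : exists v, reduced_idx v w.
Proof.
have [N] := ubnP #|Inv w|; elim: N w => // N IH w hw.
have [->|w1] := eqVneq w 1%g; first by exists [::]; split=> //; rewrite Inv1.
have [a an d] := desc_exists w1.
have [|v hv] := IH (lmul a w); first by move: hw; rewrite (Inv_lmul_desc an d) ltnS.
by exists (a :: v); apply/reduced_idx_cons; split.
Qed.

Lemma word_length_le m (A : {set 'S_m}) (s : seq 'S_m) w :
  all (fun t => t \in A) s -> wprod s = w -> word_length A w <= size s.
Proof.
move=> hs e; rewrite /word_length.
have [lt|ge] := ltnP (size s) #|{: 'S_m}|; last first.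
  by apply: leq_trans ge; rewrite -{2}(size_iota 0 #|{: 'S_m}|) find_size.
rewrite leqNgt; apply/negP => /(before_find 0) /=.
rewrite nth_iota // add0n => /negbT/existsPn /(_ (in_tuple s)).
by rewrite /= hs e eqxx.
Qed.

Lemma word_length_eq m (A : {set 'S_m}) (s : seq 'S_m) w :
  all (fun t => t \in A) s -> wprod s = w -> size s < #|{: 'S_m}| ->
  (forall s', all (fun t => t \in A) s' -> wprod s' = w -> size s <= size s') ->
  word_length A w = size s.
Proof.
move=> hs e lt min; apply/eqP; rewrite eqn_leq word_length_le //=.
have h : has (fun k => [exists s : k.-tuple 'S_m,
                    all (fun t => t \in A) s && (wprod s == w)])
       (iota 0 #|{: 'S_m}|).
  apply/hasP; exists (size s); first by rewrite mem_iota.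
  by apply/existsP; exists (in_tuple s); rewrite /= hs e eqxx.
have := nth_find 0 h; rewrite nth_iota; last by move: h; rewrite has_find size_iota.
rewrite add0n => /existsP [s' /andP [hs' /eqP e']].
by have := min _ hs' e'; rewrite size_tuple.
Qed.

(** [word_length] searches only below the order of the group; this estimate puts every possible
    number of inversions within the search range. *)
Lemma bin2_lt_fact n : 'C(n.+1, 2) < (n.+1)`!.
Proof.
elim: n => // n IH; rewrite binS bin1 factS.
have := fact_gt0 n.+1; nia.
Qed.

Lemma Inv_le n (w : 'S_n.+1) : #|Inv w| <= 'C(n.+1, 2).
Proof.
rewrite -bin2_sum big_mkord.
rewrite -sum1_card (partition_big (fun p : 'I_n.+1 * 'I_n.+1 => p.2) predT) //=.
apply: leq_sum => k _; rewrite sum1dep_card.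
set f := fun x : 'I_k => (widen_ord (ltnW (ltn_ord k)) x, k).
apply: (@leq_trans #|f @: 'I_k|); last by rewrite (leq_trans (leq_imset_card _ _)) ?card_ord.
apply/subset_leq_card/subsetP => [[i j]]; rewrite !inE /= => /andP [/andP [ij _] /eqP e].
subst j; apply/imsetP; exists (Ordinal ij) => //; rewrite /f; congr pair; exact: val_inj.
Qed.

Lemma simples_word n (s : seq 'S_n.+1) : all (fun t => t \in simples n) s ->
  exists2 v, all (fun a => a < n) v & s = map (adj_tperm n) v.
Proof.
elim: s => [|t s IH] /=; first by exists [::].
case/andP=> /simplesP [a an ->] /IH [v hv ->]; exists (a :: v) => //=.
by rewrite an.
Qed.

Lemma simples_map n v : all (fun a => a < n) v ->
  all (fun t => t \in simples n) (map (adj_tperm n) v).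
Proof. by move/allP => h; apply/allP => t /mapP [a /h an ->]; exact: adj_tperm_simples. Qed.

Lemma ellSE n (w : 'S_n.+1) : ellS w = #|Inv w|.
Proof.
have [v [hv e sz]] := reduced_idx_exists w.
rewrite -sz -(size_map (adj_tperm n)); apply: word_length_eq => //; first exact: simples_map.
  rewrite size_map sz card_Sn; exact: leq_ltn_trans (Inv_le w) (bin2_lt_fact n).
move=> s' /simples_word [v' hv' ->] e'; rewrite !size_map sz -e'.
exact: Inv_wprod.
Qed.

Lemma reduced_wordE n (w : 'S_n.+1) v : all (fun a => a < n) v ->
  reduced_word (map (adj_tperm n) v) w <-> reduced_idx v w.
Proof.
move=> hv; split=> [[_ e sz]|[_ e sz]]; split=> //.
- by rewrite -ellSE -sz size_map.
- by apply/allP; apply: simples_map.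
- by rewrite ellSE -sz size_map.
Qed.

(** * Greedy sorting words and aligned permutations *)

(* When u is an index word of c, this says that j lies in R_c. *)
Definition tau (u : seq nat) (j : nat) : bool := index j.-1 u < index j u.

(* The first part says that w lies in the parabolic subgroup of the letters of u. *)
Definition aligned n (u : seq nat) (w : 'S_n.+1) : Prop :=
  (forall i k, i < k -> k <= n -> pos w k < pos w i ->
     forall m, i <= m -> m < k -> m \in u) /\
  (forall i j k, i < j -> j < k -> k <= n -> pos w k < pos w i ->
     if tau u j then pos w j < pos w i else pos w k < pos w j).

Lemma tau_cons a u j :
  tau (a :: u) j = if j == a then false else if j == a.+1 then true else tau u j.
Proof.
have ic x : index x (a :: u) = if a == x then 0 else (index x u).+1 by [].
rewrite /tau !ic; have [->|ja] := eqVneq j a; first by rewrite ltn0.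
have [->|ja1] := eqVneq j a.+1; first by rewrite /= eqxx.
by have -> : (a == j.-1) = false by lia.
Qed.

Lemma tau_rcons a u j : 0 < j -> a \notin u -> j.-1 \in rcons u a -> j \in rcons u a ->
  tau (rcons u a) j = if j == a then true else if j == a.+1 then false else tau u j.
Proof.
move=> j0 au; have i1 x : index x [:: a] = (a != x) by rewrite /=; case: (a == x).
rewrite /tau !mem_rcons !inE -cats1 !index_cat !i1.
have [e|ja] := eqVneq j a.
  subst j; have -> : (a.-1 == a) = false by lia.
  by move=> /= h _; rewrite h (negPf au) addn0 index_mem.
have [->|ja1] := eqVneq j a.+1.
  move=> _ /= h; rewrite (negPf au) h ?eqxx addn0; apply/negbTE.
  by rewrite -leqNgt ltnW // index_mem.
have -> : (j.-1 == a) = false by lia.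
by move=> /= -> ->.
Qed.

(** In [a :: u] the label [a] is on the left and [a.+1] on the right; in [rcons u a] it is the
    reverse, and no other comparison of consecutive letters changes. *)
Lemma tau_rot a u j : 0 < j -> a \notin u -> j.-1 \in rcons u a -> j \in rcons u a ->
  tau (rcons u a) j = tau (a :: u) (adj_swap a j).
Proof.
move=> j0 au jp jj; rewrite tau_rcons //.
have eS : (a.+1 == a) = false by lia.
case: (adj_swapP a j) => [[-> ->]|[[-> ->]|[? [? ->]]]]; rewrite tau_cons.
- by rewrite eS !eqxx.
- by rewrite eS !eqxx.
- by do 2 (case: eqP => // _).
Qed.

Section AlignedStep.

Variables (n a : nat) (u : seq nat) (w : 'S_n.+1).
Hypotheses (an : a < n) (au : a \notin u).

Lemma aligned_skip : ~~ desc w a -> aligned (a :: u) w <-> aligned u w.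
Proof.
rewrite descE // => d; split=> [[hs ht]|[hs ht]].
  (* No inversion straddles the skipped letter: since [a] is on the left, such a [k] would precede
     [a]; since [a.+1] is on the right, [a.+1] would then precede [a], against the hypothesis. *)
  have key i k : i < k -> k <= n -> pos w k < pos w i -> i <= a -> a < k -> False.
    move=> ik kn h ia ak.
    have ha : pos w k < pos w a.
      have [<-//|ne] := eqVneq i a.
      by have := ht i a k ltac:(lia) ak kn h; rewrite tau_cons eqxx.
    have ne : k != a.+1 by apply/eqP => e; move: ha; rewrite e; lia.
    have := ht a a.+1 k ltac:(lia) ltac:(lia) kn ha.
    by rewrite tau_cons eqxx; case: eqP => [|_]; lia.
  split=> [i k ik kn h m im mk|i j k ij jk kn h].
    have := hs i k ik kn h m im mk; rewrite inE => /orP [/eqP e|//].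
    by case: (key i k) => //; lia.
  have := ht i j k ij jk kn h; rewrite tau_cons.
  case: eqP => [e|ne]; first by case: (key i k) => //; lia.
  by case: eqP => [e|ne1] //; case: (key i k) => //; lia.
split=> [i k ik kn h m im mk|i j k ij jk kn h].
  by rewrite inE (hs i k) ?orbT.
rewrite tau_cons; case: eqP => [e|ne].
  by case/negP: au; apply: (hs i k) => //; lia.
case: eqP => [e|ne1]; last exact: ht.
by case/negP: au; apply: (hs i k) => //; lia.
Qed.

Let w' := lmul a w.

Let posw' v : v <= n -> pos w' v = pos w (adj_swap a v).
Proof. exact: pos_lmul. Qed.

Lemma aligned_take : desc w a -> aligned (a :: u) w <-> aligned (rcons u a) w'.
Proof.
rewrite /desc => d.
have ms m : (m \in rcons u a) = (m \in a :: u) by rewrite mem_rcons.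
have eS : (a.+1 == a) = false by lia.
have swa : adj_swap a a = a.+1 by rewrite /adj_swap eqxx.
have swa1 : adj_swap a a.+1 = a by rewrite /adj_swap eS eqxx.
have tauE i k : i.+1 < k -> (forall m, i <= m -> m < k -> m \in rcons u a) ->
    forall j, i < j -> j < k -> tau (rcons u a) j = tau (a :: u) (adj_swap a j).
  by move=> ik hm j ij jk; apply: tau_rot => //; [lia|apply: hm; lia|apply: hm; lia].
have swlt i k : i < k -> (i, k) != (a, a.+1) -> adj_swap a i < adj_swap a k.
  move=> ik; rewrite xpair_eqE.
  have := adj_swapP a i; have := adj_swapP a k; lia.
have sube i m k : i <= m -> m < k -> [|| m == a, adj_swap a i <= m < adj_swap a k,
     (m == a.+1) && (adj_swap a i <= a < adj_swap a k)| (m.+1 == a) &&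
       (adj_swap a i <= a < adj_swap a k)].
  have := adj_swapP a i; have := adj_swapP a k; lia.
split=> [[hs ht]|[hs ht]].
  have hs' i k : i < k -> k <= n -> pos w' k < pos w' i ->
     forall m, i <= m -> m < k -> m \in rcons u a.
    move=> ik kn h m im mk; rewrite ms.
    have ne : (i, k) != (a, a.+1).
      apply/eqP => - [e1 e2]; subst i k; move: h.
      by rewrite !posw' ?swa ?swa1 //; lia.
    move: h; rewrite !posw' //; try lia; move=> h.
    have hsm := hs _ _ (swlt i k ik ne) (adj_swap_le an kn) h.
    have [->|ma] := eqVneq m a; first by rewrite inE eqxx.
    apply: hsm; move: im mk ma; have := adj_swapP a i; have := adj_swapP a k; lia.
  split=> // i j k ij jk kn h.
  rewrite (tauE i k) //; [|lia|by move=> *; apply: (hs' i k) => //; lia].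
  have iE := posw' (ltac:(lia) : i <= n); have jE := posw' (ltac:(lia) : j <= n).
  have kE := posw' kn; rewrite iE jE kE in h *.
  (* Relabelling keeps the order of a triple unless it contains the consecutive pair [a], [a.+1]; in
     those two cases the claim follows from [h] and the descent at [a]. *)
  have [[e1 e2]|ne1] := eqVneq (i, j) (a, a.+1).
    subst i j; rewrite swa swa1 tau_cons eqxx; move: h; rewrite swa; lia.
  have [[e1 e2]|ne2] := eqVneq (j, k) (a, a.+1).
    subst j k; rewrite swa swa1 tau_cons eqxx; case: eqP; [lia|].
    by move: h; rewrite swa1; lia.
  by apply: ht => //; [exact: swlt|exact: swlt|exact: adj_swap_le].
have hs' i k : i < k -> k <= n -> pos w k < pos w i ->
   forall m, i <= m -> m < k -> m \in a :: u.
  move=> ik kn h m im mk; rewrite -ms.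
  have [->|ma] := eqVneq m a; first by rewrite mem_rcons inE eqxx.
  have ne : (i, k) != (a, a.+1) by apply/eqP => - [e1 e2]; lia.
  apply: (hs (adj_swap a i) (adj_swap a k)); [exact: swlt|exact: adj_swap_le| | |].
  - by rewrite !posw' ?adj_swapK // adj_swap_le //; lia.
  - move: im mk ma; have := adj_swapP a i; have := adj_swapP a k; lia.
  - move: im mk ma; have := adj_swapP a i; have := adj_swapP a k; lia.
split=> // i j k ij jk kn h.
have [[e1 e2]|ne1] := eqVneq (i, j) (a, a.+1).
  by subst i j; rewrite tau_cons eqxx; case: eqP; [lia|].
have [[e1 e2]|ne2] := eqVneq (j, k) (a, a.+1).
  by subst j k; rewrite tau_cons eqxx.
have lij := swlt i j ij ne1; have ljk := swlt j k jk ne2.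
have := ht _ _ _ lij ljk (adj_swap_le an kn).
rewrite (tauE (adj_swap a i) (adj_swap a k)) //; last 2 first.
- lia.
- move=> m im mk; apply: (hs (adj_swap a i) (adj_swap a k)) => //; [lia|exact: adj_swap_le|].
  by rewrite !posw' ?adj_swapK // adj_swap_le //; lia.
by rewrite !posw' ?adj_swap_le ?adj_swapK //; [apply|lia|lia].
Qed.

End AlignedStep.

Lemma aligned_supp n u (w : 'S_n.+1) a : a < n -> aligned u w -> desc w a -> a \in u.
Proof. by move=> an [hs _] d; apply: (hs a a.+1). Qed.

Lemma aligned1 n u : aligned u (1%g : 'S_n.+1).
Proof.
split=> [i k ik kn|i j k ij jk kn]; rewrite !pos1 //; lia.
Qed.

Section Greedy.

Variables (n : nat) (L : nat -> nat).
Hypothesis n_gt0 : 0 < n.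
Hypothesis L_lt : forall p, L p < n.
Hypothesis L_per : forall p, L (p + n) = L p.
Hypothesis L_inj : forall p r r', p <= r < p + n -> p <= r' < p + n -> L r = L r' -> r = r'.
Hypothesis L_surj : forall p a, a < n -> exists2 r, p <= r < p + n & L r = a.

(** A relation rather than a function, because skipping a position makes nothing structurally
    smaller. *)
Inductive greedy : nat -> 'S_n.+1 -> seq nat -> Prop :=
| greedy_nil p : greedy p 1%g [::]
| greedy_take p w q : desc w (L p) -> greedy p.+1 (lmul (L p) w) q -> greedy p w (p :: q)
| greedy_skip p w q : ~~ desc w (L p) -> greedy p.+1 w q -> greedy p w q.

Lemma greedy_shift d p w q : (forall r, p <= r < p + d -> ~~ desc w (L r)) ->
  greedy (p + d) w q -> greedy p w q.
Proof.
elim: d p => [|d IH] p h; first by rewrite addn0.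
rewrite addnS -addSn => g; apply: greedy_skip; first by apply: h; lia.
by apply: IH => // r hr; apply: h; lia.
Qed.

Lemma greedy_exists p w : exists q, greedy p w q.
Proof.
have [N] := ubnP #|Inv w|; elim: N w p => // N IH w p hw.
have [->|w1] := eqVneq w 1%g; first by exists [::]; constructor.
have [a an d] := desc_exists w1; have [r hr er] := L_surj p an.
have ex : exists e, desc w (L (p + e)).
  by exists (r - p); have -> : p + (r - p) = r by [lia]; rewrite er.
case: (ex_minnP ex) => e he mine.
have [|q hq] := IH (lmul (L (p + e)) w) (p + e).+1.
  by move: hw; rewrite (Inv_lmul_desc (L_lt _) he) ltnS.
exists (p + e :: q); apply: (@greedy_shift e).
  move=> s hs; apply/negP => ds; have := mine (s - p).
  have -> : p + (s - p) = s by lia.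
  by move/(_ ds); lia.
exact: greedy_take.
Qed.

Lemma greedy_ge p w q : greedy p w q -> all (leq p) q.
Proof.
elim=> // {}p {}w {}q _ _ /allP h; rewrite /= ?leqnn; apply/allP => r /h; lia.
Qed.

Lemma greedy_sorted p w q : greedy p w q -> sorted ltn q.
Proof.
elim=> // {}p {}w {}q _ g IH /=; rewrite path_sortedE; last exact: ltn_trans.
by rewrite IH andbT (greedy_ge g).
Qed.

Lemma greedy_red p w q : greedy p w q -> reduced_idx (map L q) w.
Proof.
elim=> [{}p|{}p {}w {}q d _ IH|//]; first by split=> //=; rewrite Inv1.
by apply/reduced_idx_cons; split.
Qed.

(** A reduced word begins with a descent, so no competitor can begin at a position that is skipped.
    Where a letter is taken, a competitor either takes it too or begins later and is larger. *)
Lemma greedy_lexi p w q : greedy p w q -> forall q', all (leq p) q' -> sorted ltn q' ->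
  reduced_idx (map L q') w -> ((q : seqlexi nat) <= q')%O.
Proof.
elim=> [{}p|{}p {}w {}q d _ IH|{}p {}w {}q d _ IH] q'.
- by rewrite Order.SeqLexiOrder.lexi0s.
- case: q' => [|r q'] /=.
    move=> _ _ [_ /= e _]; move: d; rewrite -e /desc !pos1 //; have := L_lt p; lia.
  case/andP=> pr _ hs /reduced_idx_cons [_ dr hr]; rewrite Order.SeqLexiOrder.lexi_cons.
  have [e|ne] := eqVneq p r.
    subst r; rewrite lexx /=; apply: IH => //; last exact: path_sorted hs.
    by rewrite path_sortedE in hs; [case/andP: hs|exact: ltn_trans].
  have lt : (p < r)%O by rewrite ltEnat /=; lia.
  by rewrite (ltW lt) /= lt_geF.
- case: q' => [|r q'] /= h hs hr; first by apply: IH.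
  apply: IH => //=.
  case/reduced_idx_cons: hr => _ dr _; case/andP: h => pr h.
  have ne : p != r by apply: contraNneq d => ->.
  apply/andP; split; first by lia.
  move: hs; rewrite path_sortedE; last exact: ltn_trans.
  by case/andP=> /allP hs _; apply/allP => s /hs; lia.
Qed.

Definition window p (act : pred nat) : seq nat := [seq L r | r <- iota p n & act r].

(** Sortability for a reading that starts at position [p]: [act] remembers which letters of the
    coming period were used in the preceding one, and later positions must have their predecessor
    one period before in [q]. *)
Definition nested p (act : pred nat) (q : seq nat) : Prop :=
  forall r, r \in q -> (r < p + n -> act r) /\ (p + n <= r -> r - n \in q).

Lemma window_step p act : window p act =
  let u := [seq L r | r <- iota p.+1 n.-1 & act r] in if act p then L p :: u else u.
Proof. by rewrite /window; case: n n_gt0 => //= m _; case: ifP. Qed.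

Lemma window_next p (act : pred nat) b :
  window p.+1 (fun r => if r == p + n then b else act r) =
  let u := [seq L r | r <- iota p.+1 n.-1 & act r] in if b then rcons u (L p) else u.
Proof.
rewrite /window; have -> : iota p.+1 n = rcons (iota p.+1 n.-1) (p + n).
  rewrite -cats1; have -> : [:: p + n] = iota (p.+1 + n.-1) 1 by rewrite /=; congr cons; lia.
  by rewrite -iotaD; congr iota; lia.
rewrite filter_rcons eqxx.
have -> : [seq r <- iota p.+1 n.-1 | if r == p + n then b else act r] =
          [seq r <- iota p.+1 n.-1 | act r].
  by apply: eq_in_filter => r; rewrite mem_iota => h; case: eqP => //; lia.
by case: b => //=; rewrite map_rcons L_per.
Qed.

Lemma window_head_notin p (act : pred nat) :
  L p \notin [seq L r | r <- iota p.+1 n.-1 & act r].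
Proof.
apply/mapP => -[r]; rewrite mem_filter mem_iota => /andP [_ h] e.
have pr : p = r by apply: (@L_inj p) => //; lia.
by move: h; rewrite pr; lia.
Qed.

(* The window keeps the letters that a sortable element may still use: those
   not met yet, and those used at their last occurrence. *)
Lemma greedy_aligned p w q : greedy p w q -> forall act,
  nested p act q <-> aligned (window p act) w.
Proof.
elim=> [{}p act|{}p {}w {}q d g IH act|{}p {}w {}q d g IH act].
- by split=> // _; exact: aligned1.
- have nt := window_head_notin p act; have hq := allP (greedy_ge g).
  rewrite window_step /=; case: (boolP (act p)) => actp; last first.
    (* When the letter taken is inactive both sides fail: [p] violates nesting, and a descent has to
       be a letter of the window. *)
    split=> [h|h]; first by case: (h p); rewrite ?inE ?eqxx // (negPf actp) => /(_ ltac:(lia)).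
    by case/negP: nt; apply: aligned_supp h d.
  rewrite (aligned_take (L_lt p) nt d).
  have := IH (fun r => if r == p + n then true else act r); rewrite window_next /= => <-.
  split=> h r.
    move=> rq; have := hq r rq => pr; have [h1 h2] := h r (mem_behead (s := _ :: q) rq).
    split=> [lt|ge]; first by case: eqP => // ne; apply: h1; lia.
    by have := h2 ltac:(lia); rewrite inE => /orP [/eqP|//]; lia.
  rewrite inE => /orP [/eqP ->|rq]; first by split=> //; lia.
  have := hq r rq => pr; have [h1 h2] := h r rq.
  split=> [lt|ge]; first by have := h1 ltac:(lia); case: eqP => //; lia.
  have [->|ne] := eqVneq r (p + n); first by rewrite addnK inE eqxx.
  by rewrite inE h2 ?orbT //; lia.
- have nt := window_head_notin p act; have hq := allP (greedy_ge g).
  have -> : aligned (window p act) w <->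
            aligned [seq L r | r <- iota p.+1 n.-1 & act r] w.
    by rewrite window_step /=; case: ifP => // _; exact: aligned_skip.
  have := IH (fun r => if r == p + n then false else act r); rewrite window_next /= => <-.
  split=> h r rq; have := hq r rq => pr; have [h1 h2] := h r rq.
    split=> [lt|ge]; last by apply: h2; lia.
    (* Position [p + n] cannot be used once [p] is skipped: nesting would ask for [p], while all
       remaining positions exceed [p]. *)
    case: eqP => [e|ne]; last by apply: h1; lia.
    by have := hq (r - n) (h2 ltac:(lia)); lia.
  split=> [lt|ge]; first by have := h1 ltac:(lia); case: eqP => //; lia.
  have [e|ne] := eqVneq r (p + n); first by have := h1 ltac:(lia); rewrite e eqxx.
  by apply: h2; lia.
Qed.

End Greedy.

(** * The order of the inversions *)

Definition nat_tperm n (i k : nat) : 'S_n.+1 := tperm (inord i) (inord k).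

Definition inv_word n (v : seq nat) : seq 'S_n.+1 := inversion_seq (map (adj_tperm n) v).

Lemma pconjM m (u v t : 'S_m) : pconj (pmul u v) t = pconj u (pconj v t).
Proof. by rewrite /pconj /pmul invMg !mulgA. Qed.

Lemma pconj1 m (t : 'S_m) : pconj 1%g t = t.
Proof. by rewrite /pconj /pmul invg1 mul1g mulg1. Qed.

Lemma pconjJ m (w t : 'S_m) : pconj w t = (t ^ w)%g.
Proof. by []. Qed.

Lemma pconj_inj m (w : 'S_m) : injective (pconj w).
Proof. by move=> x y; rewrite !pconjJ => /conjg_inj. Qed.

Lemma pconj_tperm m (w : 'S_m) i k : pconj w (tperm i k) = tperm (w i) (w k).
Proof. by rewrite pconjJ tpermJ. Qed.

Lemma nat_tperm_inj n i k i' k' : i < k -> k <= n -> i' < k' -> k' <= n ->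
  nat_tperm n i k = nat_tperm n i' k' -> i = i' /\ k = k'.
Proof.
move=> ik kn ik' kn' e.
have vE a b : a <= n -> b <= n -> inord a = inord b :> 'I_n.+1 -> a = b.
  by move=> an bn /(congr1 val) /=; rewrite !inordK.
have := tpermL (inord i) (inord k : 'I_n.+1); rewrite -/(nat_tperm n i k) e.
have := tpermR (inord i) (inord k : 'I_n.+1); rewrite -/(nat_tperm n i k) e.
rewrite /nat_tperm; case: tpermP => [/vE h1 /vE h2|/vE h1 /vE h2|/eqP h1 /eqP h2 /vE h3];
  case: tpermP => [/vE h4 /vE h5|/vE h4 /vE h5|/eqP h4 /eqP h5 /vE h6]; lia.
Qed.

Lemma pconj_adj_nat_tperm n a i k : a < n -> i <= n -> k <= n ->
  pconj (adj_tperm n a) (nat_tperm n i k) = nat_tperm n (adj_swap a i) (adj_swap a k).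
Proof. by move=> an iN kn; rewrite pconj_tperm !adj_tperm_inord. Qed.

Lemma inv_word_cons n a v : inv_word n (a :: v) = adj_tperm n a :: map (pconj (adj_tperm n a))
  (inv_word n v).
Proof.
rewrite /inv_word /inversion_seq /=; congr cons; first by rewrite pconj1.
rewrite -[1]/(1 + 0) iotaDl -!map_comp; apply: eq_map => j /=.
by rewrite add0n pconjM.
Qed.

Lemma inv_wordP n v (w : 'S_n.+1) t : reduced_idx v w ->
  reflect (exists i k, [/\ i < k, k <= n,
    pos w k < pos w i & t = nat_tperm n i k]) (t \in inv_word n v).
Proof.
elim: v w t => [|a v IH] w t.
  case=> _ /= <- _; apply: (iffP idP) => // -[i [k [ik kn]]].
  by rewrite !pos1 //; lia.
case/reduced_idx_cons=> an d hr; rewrite inv_word_cons inE; apply: (iffP orP).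
  case=> [/eqP ->|/mapP [t' /(IH _ _ hr) [i [k [ik kn hp ->]]] ->]].
    by exists a, a.+1; split.
  rewrite pconj_adj_nat_tperm //; last lia.
  rewrite !pos_lmul // in hp; last lia.
  exists (adj_swap a i), (adj_swap a k); split=> //; last exact: adj_swap_le.
  have [[e1 e2]|] := eqVneq (i, k) (a, a.+1).
    by move: hp d; rewrite /desc e1 e2 /adj_swap !eqxx; case: eqP; lia.
  by rewrite xpair_eqE; have := adj_swapP a i; have := adj_swapP a k; lia.
move=> [i [k [ik kn hp ->]]].
have [[-> ->]|ne] := eqVneq (i, k) (a, a.+1); [by left|right].
apply/mapP; exists (nat_tperm n (adj_swap a i) (adj_swap a k)); last first.
  by rewrite pconj_adj_nat_tperm ?adj_swapK ?adj_swap_le //; lia.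
apply/(IH _ _ hr); exists (adj_swap a i), (adj_swap a k); split; rewrite ?adj_swap_le //.
  by move: ne; rewrite xpair_eqE; have := adj_swapP a i; have := adj_swapP a k; lia.
by rewrite !pos_lmul ?adj_swap_le ?adj_swapK //; lia.
Qed.

Lemma inv_word_uniq n v (w : 'S_n.+1) : reduced_idx v w -> uniq (inv_word n v).
Proof.
elim: v w => // a v IH w /reduced_idx_cons [an d hr]; rewrite inv_word_cons /=.
rewrite (map_inj_uniq (@pconj_inj _ _)) (IH _ hr) andbT.
apply/mapP => -[t /(inv_wordP _ hr) [i [k [ik kn hp ->]]]].
rewrite pconj_adj_nat_tperm //; last lia.
have [[e1 e2]|] := eqVneq (i, k) (a, a.+1).
  move: hp d; rewrite /desc e1 e2 !pos_lmul //; last lia.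
  by rewrite /adj_swap !eqxx; case: eqP; lia.
rewrite xpair_eqE => ne e; have hi := adj_swapP a i; have hk := adj_swapP a k.
by have [] := @nat_tperm_inj n a a.+1 (adj_swap a i) (adj_swap a k) _ _ _ _ e; lia.
Qed.

Section InversionOrder.

Variables (n : nat) (L : nat -> nat).
Hypothesis n_gt0 : 0 < n.
Hypothesis L_lt : forall p, L p < n.
Hypothesis L_per : forall p, L (p + n) = L p.
Hypothesis L_inj : forall p r r', p <= r < p + n -> p <= r' < p + n -> L r = L r' -> r = r'.

Lemma index_inv_word_cons a v i k : a < n -> i < k -> k <= n -> (i, k) != (a, a.+1) ->
  index (nat_tperm n i k) (inv_word n (a :: v)) = (index (nat_tperm n (adj_swap a i) (adj_swap
    a k)) (inv_word n v)).+1.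
Proof.
move=> an ik kn ne; rewrite inv_word_cons /=.
have -> : (adj_tperm n a == nat_tperm n i k) = false.
  by apply: contraNF ne => /eqP /(nat_tperm_inj (leqnn _) an ik kn) [-> ->].
rewrite -[in RHS](index_map (@pconj_inj _ (adj_tperm n a))) pconj_adj_nat_tperm ?adj_swapK
  ?adj_swap_le //; lia.
Qed.

Lemma index_inv_word_head a v : index (nat_tperm n a a.+1) (inv_word n (a :: v)) = 0.
Proof. by rewrite inv_word_cons /= eqxx. Qed.

(** The reflection of a taken letter [a] comes before all others. It concerns [j] only if [j] is
    [a.+1], on the right, as the pair of [i] and [j], or [a], on the left, as the pair of [j] and
    [k], which agrees with the claim. All other triples are relabelled, and [tau_rot] says that the
    sides follow. *)
Lemma greedy_inversion_order p (w : 'S_n.+1) q : greedy L p w q -> forall act,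
  aligned (window n L p act) w ->
  forall i j k, i < j -> j < k -> k <= n -> pos w j < pos w i -> pos w k < pos w j ->
  forall l, l = inv_word n (map L q) ->
  if tau (window n L p act) j then index (nat_tperm n i j) l < index (nat_tperm n j k) l
  else index (nat_tperm n j k) l < index (nat_tperm n i j) l.
Proof.
elim=> [{}p act al|{}p {}w {}q d g IH act al|{}p {}w {}q d g IH act al] i j k ij jk kn hij hjk l lE.
- by move: hij hjk; rewrite !pos1 //; lia.
- have nt := window_head_notin n_gt0 L_inj p act.
  have actp : act p.
    apply: contraT => actp; have := aligned_supp (L_lt p) al d.
    by rewrite window_step //= (negPf actp) (negPf nt).
  have := IH (fun r => if r == p + n then true else act r); rewrite window_next //=.
  move: al; rewrite window_step //= actp; rewrite map_cons in lE; move: nt.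
  set u := [seq L r | r <- _]; move: (L p) (L_lt p) d lE => a an d lE nt al.
  have al' := (aligned_take an nt d).1 al; move=> /(_ al') {}IH.
  have [[e1 e2]|ne1] := eqVneq (i, j) (a, a.+1).
    subst i j; rewrite tau_cons eqxx; case: eqP => [|_]; first lia.
    by rewrite lE index_inv_word_head index_inv_word_cons // ?xpair_eqE; lia.
  have [[e1 e2]|ne2] := eqVneq (j, k) (a, a.+1).
    subst j k; rewrite tau_cons eqxx.
    by rewrite lE index_inv_word_head index_inv_word_cons // ?xpair_eqE; lia.
  rewrite lE !index_inv_word_cons //; last by lia.
  have hi := adj_swapP a i; have hj := adj_swapP a j; have hk := adj_swapP a k.
  rewrite !xpair_eqE in ne1 ne2.
  have hs m : adj_swap a i <= m -> m < adj_swap a k -> m \in rcons u a.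
    by apply: (al'.1 (adj_swap a i) (adj_swap a k));
      rewrite ?pos_lmul ?adj_swapK ?adj_swap_le //; lia.
  rewrite !ltnS -{1}(adj_swapK a j) -tau_rot //; [|lia|apply: hs; lia|apply: hs; lia].
  by apply: IH => //; rewrite ?pos_lmul ?adj_swapK ?adj_swap_le //; lia.
- have nt := window_head_notin n_gt0 L_inj p act.
  move: al; rewrite window_step //=; set u := [seq L r | r <- _] => al.
  have al' : aligned u w by move: al; case: ifP => // _ /(aligned_skip (L_lt p) nt d).
  have := IH (fun r => if r == p + n then false else act r); rewrite window_next //=.
  move=> /(_ al' i j k ij jk kn hij hjk l lE).
  suff -> : tau (if act p then L p :: u else u) j = tau u j by [].
  case: ifP => // _; rewrite tau_cons.
  have hs m : i <= m -> m < k -> m \in u by apply: al'.1; lia.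
  case: eqP => [e|_]; first by case/negP: nt; rewrite -/u -e hs //; lia.
  by case: eqP => [e|_] //; case/negP: nt; rewrite -/u hs //; lia.
Qed.

End InversionOrder.

(** * The sorting word of a permutation *)

Lemma adj_tperm_inj n a b : a < n -> b < n -> adj_tperm n a = adj_tperm n b -> a = b.
Proof. by move=> an bn e; have [] := nat_tperm_inj (leqnn a.+1) an (leqnn b.+1) bn e. Qed.

Lemma wprod_stable n (s : seq 'S_n.+1) a : {subset s <= simples n} -> adj_tperm n a \notin s ->
  forall i : 'I_n.+1, (wprod s i <= a) = (i <= a).
Proof.
elim: s => [|t s IH] hs ha i; first by rewrite perm1.
rewrite wprod_cons pmulE.
have /simplesP [b bn tb] : t \in simples n by apply: hs; rewrite inE eqxx.
rewrite tb adj_tperm_val //; move: ha; rewrite inE negb_or => /andP [ne ha].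
have ab : a <> b by move=> e; move: ne; rewrite tb e eqxx.
rewrite -(IH _ ha i); last by move=> u us; apply: hs; rewrite inE us orbT.
by have := adj_swapP b (wprod s i); lia.
Qed.

Lemma wprod_cat m (s1 s2 : seq 'S_m) : wprod (s1 ++ s2) = pmul (wprod s1) (wprod s2).
Proof.
elim: s1 => [|t s IH] /=; first by rewrite /pmul mulg1.
by rewrite IH /pmul mulgA.
Qed.

Lemma wprod_rcons m (s : seq 'S_m) t : wprod (rcons s t) = pmul (wprod s) t.
Proof. by rewrite -cats1 wprod_cat wprod_cons /pmul /= mul1g. Qed.

(** A reduced word has at most the [n] letters of the defining word, so it suffices that every
    simple reflection occurs in it. If [a] did not, [c] would preserve the set of labels up to [a],
    but a product containing [a] exactly once does not. *)
Lemma coxeter_word n (c : 'S_n.+1) (cw : seq 'S_n.+1) :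
  standard_coxeter c -> reduced_word cw c ->
  exists2 cu, perm_eq cu (iota 0 n) & cw = map (adj_tperm n) cu.
Proof.
case=> s ps cs [hcw ecw szcw].
have sS t : (t \in s) = (t \in simples n) by rewrite (perm_mem ps) mem_enum.
have us : uniq s by rewrite (perm_uniq ps) enum_uniq.
have [cu hcu ecu] : exists2 v, all (fun a => a < n) v & cw = map (adj_tperm n) v.
  by apply: simples_word; apply/allP.
exists cu => //.
have szs : size cw <= n.
  rewrite szcw cs (leq_trans (word_length_le (s := s) _ erefl)) //.
    by apply/allP => t; rewrite sS.
  rewrite (perm_size ps) -cardE (leq_trans (leq_imset_card _ _)) // card_ord //.
have sub : {subset iota 0 n <= cu}.
  move=> a; rewrite mem_iota add0n => an.
  suff : adj_tperm n a \in cw.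
    rewrite ecu => /mapP [b bcu e]; rewrite (adj_tperm_inj an _ e) //.
    exact: (allP hcu).
  apply: contraT => na.
  have := adj_tperm_simples an; rewrite -sS => /splitPr e; case: e us sS cs => s1 s2 us sS cs.
  move: us; rewrite cat_uniq /= => /and3P [_ /norP [n1 _] /andP [n2 _]].
  have st := wprod_stable hcw na; rewrite ecw cs wprod_cat wprod_cons in st.
  have st1 := wprod_stable (s := s1) _ n1; have st2 := wprod_stable (s := s2) _ n2.
  have h1 i : (wprod s1 i <= a) = (i <= a).
    by apply: st1 => t ts; rewrite -sS mem_cat ts.
  have h2 i : (wprod s2 i <= a) = (i <= a).
    by apply: st2 => t ts; rewrite -sS mem_cat inE ts !orbT.
  (* The test point is the label that the factors to the right of [a] send to [a]: it is at most
     [a], and its image under [c] is not. *)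
  have := st ((wprod s2)^-1%g (inord a)).
  rewrite !pmulE permKV h1 adj_tperm_val // -(h2 ((wprod s2)^-1%g (inord a))) permKV.
  by rewrite inordK ?leqnn; [rewrite /adj_swap eqxx ltnn|lia].
have szc : size cu <= size (iota 0 n) by rewrite size_iota -(size_map (adj_tperm n)) -ecu.
rewrite perm_sym; apply: uniq_perm; rewrite ?iota_uniq //.
  by rewrite (leq_size_uniq _ sub) ?iota_uniq.
by have [] := uniq_min_size (iota_uniq 0 n) sub szc.
Qed.

Section SortingWord.

Variables (n : nat) (cu : seq nat).
Hypothesis n_gt0 : 0 < n.
Hypothesis cuP : perm_eq cu (iota 0 n).

Let cw := map (adj_tperm n) cu.
Definition cyc_letter (p : nat) := nth 0 cu (p %% n).
Let L := cyc_letter.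

Let cu_size : size cu = n.
Proof. by rewrite (perm_size cuP) size_iota. Qed.

Let cu_uniq : uniq cu.
Proof. by rewrite (perm_uniq cuP) iota_uniq. Qed.

Let mod_lt p : p %% n < size cu.
Proof. by rewrite cu_size ltn_mod. Qed.

Lemma cyc_letter_lt p : L p < n.
Proof. by have := mem_nth 0 (mod_lt p); rewrite (perm_mem cuP) mem_iota. Qed.

Lemma cyc_letter_per p : L (p + n) = L p.
Proof. by rewrite /L /cyc_letter modnDr. Qed.

Lemma cyc_letter_modn p r : L p = L r -> p %% n = r %% n.
Proof. by move/eqP; rewrite nth_uniq // => /eqP. Qed.

Lemma cyc_letter_inj p r r' : p <= r < p + n -> p <= r' < p + n -> L r = L r' -> r = r'.
Proof.
move=> hr hr' /cyc_letter_modn e.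
wlog le : r r' hr hr' e / r <= r'.
  by move=> H; case/orP: (leq_total r r') => h; [|symmetry]; apply: H.
have dv : n %| r' - r by rewrite -eqn_mod_dvd // e.
have [//|ne] := eqVneq r r'.
have lt : 0 < r' - r by lia.
by have := dvdn_leq lt dv; lia.
Qed.

Lemma cyc_letter_surj p a : a < n -> exists2 r, p <= r < p + n & L r = a.
Proof.
move=> an; have acu : a \in cu by rewrite (perm_mem cuP) mem_iota.
have ia : index a cu < n by rewrite -cu_size index_mem.
have pm : p %% n < n by rewrite ltn_mod.
pose e := (index a cu + (n - p %% n)) %% n.
exists (p + e); first by rewrite leq_addr ltn_add2l ltn_mod.
rewrite /L /cyc_letter; suff -> : (p + e) %% n = index a cu by rewrite nth_index.
rewrite /e modnDmr.
have -> : p + (index a cu + (n - p %% n)) = (p %/ n).+1 * n + index a cu.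
  by rewrite {1}(divn_eq p n) mulSn; lia.
by rewrite modnMDl modn_small.
Qed.

Let letterE p : letter_at cw p = adj_tperm n (L p).
Proof. by rewrite /letter_at size_map cu_size (nth_map 0). Qed.

Let subwordE q : subword_at cw q = map (adj_tperm n) (map L q).
Proof. by rewrite /subword_at -map_comp; apply: eq_map => p /=; rewrite letterE. Qed.

Let allL q : all (fun a => a < n) (map L q).
Proof. by apply/allP => a /mapP [p _ ->]; exact: cyc_letter_lt. Qed.

Lemma sorting_positions_greedy w q : greedy L 0 w q -> sorting_positions cw w = q.
Proof.
move=> g.
have all0 (s : seq nat) : all (leq 0) s by apply/allP.
have spec : sorting_positions_spec cw w q.
  split; first split; first exact: (greedy_sorted n_gt0 g).
    by rewrite subwordE; apply/reduced_wordE => //; exact: (greedy_red cyc_letter_lt g).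
  move=> q' [sq']; rewrite subwordE => /(reduced_wordE _ (allL q')) hr.
  exact: (greedy_lexi n_gt0 cyc_letter_lt g (all0 q') sq' hr).
have [[sq hq] minq] := classical_sets.xgetPex [::] (ex_intro _ q spec).
case: spec => [rq mq].
by apply/(@le_anti _ (seqlexi nat)); rewrite minq // mq.
Qed.

Lemma window_cu : window n L 0 predT = cu.
Proof.
rewrite /window filter_predT -[RHS](mkseq_nth 0 cu) /mkseq cu_size.
by apply/eq_in_map => p; rewrite mem_iota /L /cyc_letter => h; rewrite modn_small.
Qed.

Lemma sortable_nested w q : greedy L 0 w q -> sortable cw w <-> nested n 0 predT q.
Proof.
move=> g; rewrite /sortable /sorting_block (sorting_positions_greedy g).
have inB t i : reflect (exists2 r, r \in q & r %/ n = i /\ t = adj_tperm n (L r))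
    (t \in subword_at cw [seq p <- q | p %/ size cw == i]).
  rewrite subwordE -map_comp size_map cu_size.
  apply: (iffP mapP) => [[r]|[r rq [ri ->]]].
    by rewrite mem_filter => /andP [/eqP ri rq] ->; exists r.
  by exists r => //; rewrite mem_filter rq ri eqxx.
split=> [h r rq|h i t /inB [r rq [ri ->]]].
  split=> // nr; rewrite add0n in nr.
  have : adj_tperm n (L r) \in subword_at cw [seq p <- q | p %/ size cw == (r - n) %/ n].
    apply: h; apply/inB; exists r => //; split=> //.
    by rewrite -{1}(subnK nr) divnDr // divnn n_gt0 addn1.
  case/inB=> r' rq' [e /adj_tperm_inj e'].
  suff -> : r - n = r' by [].
  rewrite (divn_eq r' n) e {1}(divn_eq (r - n) n); congr (_ + _).
  rewrite -(cyc_letter_modn (e' (cyc_letter_lt _) (cyc_letter_lt _))).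
  by rewrite -{2}(subnK nr) modnDr.
have nr : n <= r by rewrite leqNgt; apply/negP => lt; move: ri; rewrite divn_small.
have [_ /(_ nr) rq'] := h r rq.
apply/inB; exists (r - n) => //; split; last by rewrite -{1}(subnK nr) cyc_letter_per.
by move: ri; rewrite -{1}(subnK nr) divnDr // divnn n_gt0 addn1 => -[].
Qed.

(** This gathers all that is used later about sorting words; positions in the infinite word do not
    occur any more. *)
Lemma sorting_word_aligned w : exists v, [/\ reduced_idx v w,
  sorting_word cw w = map (adj_tperm n) v,
  sortable cw w <-> aligned cu w & aligned cu w ->
  forall i j k, i < j -> j < k -> k <= n -> pos w j < pos w i -> pos w k < pos w j ->
  if tau cu j then index (nat_tperm n i j) (inv_word n v) < index (nat_tperm n j k) (inv_word n v)
  else index (nat_tperm n j k) (inv_word n v) < index (nat_tperm n i j) (inv_word n v)].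
Proof.
have [q g] := greedy_exists n_gt0 cyc_letter_lt cyc_letter_surj 0 w.
exists (map L q); split.
- exact: (greedy_red cyc_letter_lt g).
- by rewrite /sorting_word (sorting_positions_greedy g) subwordE.
- rewrite (sortable_nested g) (greedy_aligned n_gt0 cyc_letter_lt cyc_letter_per cyc_letter_inj g).
  by rewrite window_cu.
- move=> al i j k ij jk kn hij hjk; rewrite -window_cu in al *.
  exact: (greedy_inversion_order n_gt0 cyc_letter_lt cyc_letter_per cyc_letter_inj g al).
Qed.

End SortingWord.

(** * Products of distinct adjacent transpositions *)

(* [cyc_between x y z]: going up from x cyclically, y is met strictly between x and the
   next occurrence of z (all y <> x when x = z). *)
Definition cyc_between (x y z : nat) : bool :=
  [|| (x < y) && (y < z), (z <= x) && (x < y) | (z <= x) && (y < z)].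

(* The clockwise position of p, when [t p] says that p is on the right side of the
   circle: down along the right side, then up along the left side. *)
Definition circle_key (n : nat) (t : nat -> bool) (p : nat) : nat := if t p then p else n.*2 - p.

Lemma circle_keyP n (t : nat -> bool) p :
  t p /\ circle_key n t p = p \/ ~~ t p /\ circle_key n t p = n.*2 - p.
Proof. by rewrite /circle_key; case: ifP; [left | right]. Qed.

(** An element [k] of [e] stands for the edge joining [k] and [k.+1]; this is connectedness along
    such edges. *)
Definition linked (e : seq nat) (p q : nat) : Prop :=
  forall k, p <= k < q \/ q <= k < p -> k \in e.

Lemma linked_refl e p : linked e p p.
Proof. by move=> k; lia. Qed.

Lemma linked_sym e p q : linked e p q -> linked e q p.
Proof. by move=> h k hk; apply: h; lia. Qed.

Lemma linked_trans e p q r : linked e p q -> linked e q r -> linked e p r.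
Proof.
move=> h1 h2 k hk.
have [h|h] := boolP ((p <= k < q) || (q <= k < p)); [apply: h1|apply: h2]; lia.
Qed.

Lemma linked_notin e k p q : linked e p q -> k \notin e -> (p <= k) = (q <= k).
Proof.
move=> h; apply: contraNeq => ne; apply: h; lia.
Qed.

Lemma linked_rcons e k p q : linked (rcons e k) p q <->
  [\/ linked e p q, [/\ p <= k < q, linked e p k & linked e k.+1 q]
   | [/\ q <= k < p, linked e q k & linked e k.+1 p]].
Proof.
have sub a b : linked e a b -> linked (rcons e k) a b.
  by move=> h m hm; rewrite mem_rcons inE h ?orbT.
have lk : linked (rcons e k) k k.+1.
  by move=> m hm; have -> : m = k by [lia]; rewrite mem_rcons inE eqxx.
have mk m : m \in rcons e k -> m != k -> m \in e.
  by rewrite mem_rcons inE => /orP [/eqP ->|//]; rewrite eqxx.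
split=> [h|[h|[lt h1 h2]|[lt h1 h2]]].
- have [h1|h1] := boolP (p <= k < q).
    by constructor 2; split=> // m hm; apply: mk; [apply: h; lia|lia|apply: h; lia|lia].
  have [h2|h2] := boolP (q <= k < p).
    by constructor 3; split=> // m hm; apply: mk; [apply: h; lia|lia|apply: h; lia|lia].
  by constructor 1 => m hm; apply: mk; [apply: h; lia|lia].
- exact: sub.
- exact: linked_trans (sub _ _ h1) (linked_trans lk (sub _ _ h2)).
- by apply: linked_sym; apply: linked_trans (sub _ _ h1) (linked_trans lk (sub _ _ h2)).
Qed.

Definition nat_app n (y : 'S_n.+1) (p : nat) : nat := y (inord p).

Lemma nat_app_le n (y : 'S_n.+1) p : nat_app y p <= n.
Proof. by rewrite /nat_app -ltnS. Qed.

(* A product of distinct adjacent transpositions permutes each interval of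
   linked points cyclically; the order of the two transpositions moving an
   inner point decides on which side of the circle that point lies. *)
Lemma adjacent_prod_cyc n e (t : nat -> bool) :
  uniq e -> all (fun k => k < n) e ->
  (forall p, 0 < p -> p.-1 \in e -> p \in e -> t p = tau e p) ->
  forall p, p <= n -> let q := nat_app (wprod (map (adj_tperm n) e)) p in
    linked e p q /\
    forall m, m <= n -> linked e p m ->
      ~~ cyc_between (circle_key n t p) (circle_key n t m) (circle_key n t q).
Proof.
elim/last_ind: e => [|e k IH] /=.
  move=> _ _ _ p pn; rewrite /nat_app perm1 inordK //; split; first exact: linked_refl.
  move=> m mn h; have -> : m = p; last by rewrite /cyc_between; lia.
  apply/eqP; case: (ltngtP m p) => // lt.
    by have := h m; rewrite in_nil => /(_ ltac:(lia)).
  by have := h p; rewrite in_nil => /(_ ltac:(lia)).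
rewrite rcons_uniq all_rcons => /andP [ke ue] /andP [kn an] ht.
(* The last letter [k] comes after [k.-1] and [k.+1], so the point [k] is on the right and the point
   [k.+1] on the left whenever the neighbouring letter is present. *)
have tk : 0 < k -> k.-1 \in e -> t k.
  move=> k0 kp; rewrite ht ?tau_rcons ?mem_rcons ?inE ?kp ?eqxx ?orbT //.
have tk1 : k.+1 \in e -> t k.+1 = false.
  move=> kp; have kS : (k.+1 == k) = false by lia.
  by rewrite ht ?tau_rcons ?mem_rcons ?inE ?kp ?eqxx ?orbT ?kS.
have {}IH := IH ue an.
have {}IH p : p <= n -> let q := nat_app (wprod (map (adj_tperm n) e)) p in linked e p q /\
   forall m, m <= n -> linked e p m ->
     ~~ cyc_between (circle_key n t p) (circle_key n t m) (circle_key n t q).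
  apply: IH => {}p p0 h1 h2; rewrite ht ?tau_rcons ?mem_rcons ?inE ?h1 ?h2 ?orbT //.
  case: eqP => [e1|_]; first by rewrite -e1 h2 in ke.
  by case: eqP => [e1|_] //; rewrite e1 /= in h1; rewrite h1 in ke.
move=> p pn; rewrite map_rcons wprod_rcons.
have -> : nat_app (pmul (wprod (map (adj_tperm n) e)) (adj_tperm n k)) p = nat_app (wprod (map
  (adj_tperm n) e)) (adj_swap k p).
  by rewrite /nat_app pmulE adj_tperm_inord.
have low q : linked e q k -> q <= k /\ (q < k -> t k).
  move=> h; split=> [|lt]; first by rewrite (linked_notin h ke).
  by apply: tk; [lia|apply: h; lia].
have high q : linked e k.+1 q -> k < q /\ (k.+1 < q -> t k.+1 = false).
  move=> h; split=> [|lt]; first by have := linked_notin h ke; lia.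
  by apply: tk1; apply: h; lia.
pose K := circle_key n t.
(* The points above [k] in value form an arc around the bottom of the circle, so their keys fill a
   range that the keys of the points below [k] avoid. *)
have inK r : k < r -> r <= n -> k < K r < n.*2 - k.
  by have := circle_keyP n t r; rewrite -/K; clear; lia.
have outK r : r < k -> K r < k \/ n.*2 - k < K r.
  by have := circle_keyP n t r; rewrite -/K; move: kn; clear; lia.
have inK1 r : k.+1 < r -> r <= n -> k.+1 < K r < n.*2 - k.+1.
  by have := circle_keyP n t r; rewrite -/K; clear; lia.
have Kk : K k = k \/ K k = n.*2 - k by have := circle_keyP n t k; rewrite -/K; clear; lia.
have Kkt : t k -> K k = k by rewrite /K /circle_key => ->.
have Kk1 : K k.+1 = k.+1 \/ K k.+1 = n.*2 - k.+1.
  by have := circle_keyP n t k.+1; rewrite -/K; clear; lia.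
have Kk1t : t k.+1 = false -> K k.+1 = n.*2 - k.+1 by rewrite /K /circle_key => ->.
set y := wprod (map (adj_tperm n) e); rewrite -/K -/y in IH *.
(* The appended factor acts first: it exchanges the images of [k] and [k.+1], and joins the interval
   ending at [k] to the one starting at [k.+1]. *)
case: (adj_swapP k p) => [[e1 ->]|[[e1 ->]|[ne1 [ne2 ->]]]] /=.
- subst p; have [lq IHm] := IH k.+1 kn.
  have [q1 q2] := high _ lq; have qn := nat_app_le y k.+1.
  split; first by apply/linked_rcons; constructor 2; split=> //; [lia|exact: linked_refl].
  have qK := inK _ q1 qn.
  move=> m mn /linked_rcons; case=> [/linked_sym h|[lt _ h]|[lt _ h]]; last by lia.
    have [h1 h2] := low _ h; have [->|ne] := eqVneq m k; first by rewrite /cyc_between; lia.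
    have mk : m < k by lia.
    by have := Kkt (h2 mk); have := outK m mk; move: qK; rewrite /cyc_between; clear; lia.
  have [h1 h2] := high _ h; have := IHm _ mn h; have mK := inK _ h1 mn; rewrite /cyc_between.
  have [->|ne] := eqVneq (nat_app y k.+1) m; first by clear; lia.
  have tk1' : K k.+1 = n.*2 - k.+1.
    by apply: Kk1t; move: ne h2 q2 h1 q1; clear; case: ltngtP => //; lia.
  by move: Kk mK qK tk1'; clear; lia.
- subst p; have [lq IHm] := IH k (ltnW kn).
  have [q1 q2] := low _ (linked_sym lq).
  split.
    apply/linked_rcons; constructor 3; split=> //; [lia|exact: linked_sym|].
    exact: linked_refl.
  have qK : K (nat_app y k) <= k \/ n.*2 - k <= K (nat_app y k).
    have [->|ne] := eqVneq (nat_app y k) k; first by move: Kk; clear; lia.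
    by have := outK (nat_app y k); move: ne q1; clear; lia.
  move=> m mn /linked_rcons; case=> [h|[lt _ h]|[lt h _]]; [|lia|].
    have [h1 h2] := high _ h; have [->|ne] := eqVneq m k.+1; first by rewrite /cyc_between; lia.
    have mk : k.+1 < m by lia.
    by have := Kk1t (h2 mk); have := inK1 m mk mn; move: qK; rewrite /cyc_between; clear; lia.
  have [h1 h2] := low _ h; have := IHm _ mn (linked_sym h); rewrite /cyc_between.
  have [->|ne] := eqVneq (nat_app y k) m; first by clear; lia.
  have mK : K m <= k \/ n.*2 - k <= K m.
    have [->|ne'] := eqVneq m k; first by move: Kk; clear; lia.
    by have := outK m; move: ne' h1; clear; lia.
  have tk' : K k = k.
    by apply: Kkt; move: ne h2 q2 h1 q1; clear; lia.
  by move: Kk1 mK qK tk' kn; clear; lia.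
have [lq IHm] := IH p pn.
have qn := nat_app_le y p.
split; first by apply/linked_rcons; constructor 1.
move=> m mn /linked_rcons.
have lqk := linked_notin lq ke.
case=> [h|[lt h h']|[lt h h']]; first exact: IHm.
- have := IHm _ (ltnW kn) h; rewrite /cyc_between; have [_ h1] := low _ h; have [h2 _] := high _ h'.
  have pk : p < k by lia.
  have tk' := Kkt (h1 pk); have pK := outK p pk; have mK := inK m h2 mn.
  have [->|ne] := eqVneq (nat_app y p) k; first by move: tk' pK mK; clear; lia.
  have qK : K (nat_app y p) < k \/ n.*2 - k < K (nat_app y p) by apply: outK; lia.
  by move: tk' pK mK qK; clear; lia.
have := IHm _ kn (linked_sym h'); rewrite /cyc_between; have [_ h1] := high _ h';
  have [h2 _] := low _ h.
have pk : k.+1 < p by lia.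
have tk' := Kk1t (h1 pk); have pK := inK1 p pk pn.
have mK : K m <= k \/ n.*2 - k <= K m.
  have [->|ne'] := eqVneq m k; first by move: Kk; clear; lia.
  by have := outK m; move: ne' h2; clear; lia.
have [->|ne] := eqVneq (nat_app y p) k.+1; first by move: tk' pK mK; clear; lia.
have qK : k.+1 < K (nat_app y p) < n.*2 - k.+1 by apply: inK1 => //; lia.
by move: tk' pK mK qK; clear; lia.
Qed.

(** * Clockwise noncrossing permutations *)

Section CyclicOrder.

Variables (n : nat) (key : 'I_n.+1 -> nat).
Hypothesis key_inj : injective key.

Local Notation cy i m j := (cyc_between (key i) (key m) (key j)).

(* For a permutation whose cycles turn clockwise, this is noncrossing: a block
   meeting the open arc from i to x i stays inside it. *)
Definition clockwise_nc (x : 'S_n.+1) : Prop :=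
  forall i m, cy i m (x i) -> cy i (x m) (x i).

(** The rotation of the whole circle by one point. *)
Definition successor (c : 'S_n.+1) : Prop := forall i m, ~~ cy i m (c i).

Let keyE i j : (key i == key j) = (i == j).
Proof. exact: inj_eq. Qed.

Lemma porbit_step (x : 'S_n.+1) a i : (x i \in porbit x a) = (i \in porbit x a).
Proof. by rewrite -!eq_porbit_mem -[x i]/((x ^+ 1)%g i) porbit_perm. Qed.

(** Take for [i] the orbit element from which [b] is reached soonest going clockwise; [dist] is this
    distance, computed modulo a number [M] exceeding all keys. *)
Lemma orbit_gap (x : 'S_n.+1) a b : b \notin porbit x a ->
  exists2 i, i \in porbit x a & cy i b (x i).
Proof.
move=> ba; pose M := (\max_i key i).+1.
have ltM i : key i < M by rewrite ltnS leq_bigmax.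
pose dist i := if key i < key b then key b - key i else key b + M - key i.
have [i hi mini] := @arg_minnP _ a (mem (porbit x a)) dist (porbit_id x a).
exists i => //; have := mini (x i); rewrite /= porbit_step => /(_ hi).
have : key i != key b by rewrite keyE; apply: contraNneq ba => <-.
have : key (x i) != key b by rewrite keyE; apply: contraNneq ba => <-; rewrite porbit_step.
have := ltM i; have := ltM b; have := ltM (x i).
have distP j : key j < key b /\ dist j = key b - key j \/
    key b <= key j /\ dist j = key b + M - key j.
  by rewrite /dist; case: ltnP; [left | right].
have := distP i; have := distP (x i); rewrite /cyc_between; clear; lia.
Qed.

Lemma porbit_cyc (x : 'S_n.+1) (S : {set 'I_n.+1}) i :
  (forall j, j \in S -> x j \in S) -> (forall j m, j \in S -> m \in S -> ~~ cy j m (x j)) ->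
  i \in S -> porbit x i = S.
Proof.
move=> hS hc iS.
have sub : porbit x i \subset S.
  apply/subsetP => _ /porbitP [k ->]; elim: k => [|k IH]; first by rewrite perm1.
  by rewrite expgSr permM; exact: hS.
apply/eqP; rewrite eqEsubset sub; apply/subsetP => m mS.
apply: contraT => /orbit_gap [j /(subsetP sub) jS]; apply: contraLR => _; exact: hc.
Qed.

(** This is how a permutation with clockwise cycles is recovered from its orbits. *)
Lemma successor_uniq (x y : 'S_n.+1) i (S : {set 'I_n.+1}) :
  x i \in S -> y i \in S -> (forall m, m \in S -> ~~ cy i m (x i)) ->
  (forall m, m \in S -> ~~ cy i m (y i)) -> i \in S -> x i = y i.
Proof.
move=> xS yS hx hy iS; apply/eqP; rewrite -keyE; have := hx _ yS; have := hy _ xS.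
have := hx _ xS; have := hx _ iS; have := hy _ iS; rewrite /cyc_between; clear; lia.
Qed.

Lemma clockwise_nc_orbit x i m m' : clockwise_nc x -> cy i m (x i) ->
  m' \in porbit x m -> cy i m' (x i).
Proof.
move=> hx h /porbitP [k ->]; elim: k => [|k IH]; first by rewrite perm1.
by rewrite expgSr permM; exact: hx.
Qed.

(** An orbit element strictly inside the arc would drag its whole orbit inside, including the
    endpoint [i]. *)
Lemma clockwise x i m : clockwise_nc x -> m \in porbit x i -> ~~ cy i m (x i).
Proof.
move=> hx mi; apply/negP => h; rewrite porbit_sym in mi.
by have := clockwise_nc_orbit hx h mi; rewrite /cyc_between; clear; lia.
Qed.

Lemma noncrossing x a b c d : clockwise_nc x -> a != c -> cy a b c -> cy c d a ->
  c \in porbit x a -> d \in porbit x b -> b \in porbit x a.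
Proof.
move=> hx; rewrite -keyE => ac abc cda ca db; apply: contraT => /[dup] ba /orbit_gap [i ia h].
have ci := h; have di := clockwise_nc_orbit hx h db.
have ai : ~~ cy i a (x i) by apply: clockwise => //; rewrite porbit_sym.
have : ~~ cy i c (x i).
  by apply: clockwise => //; rewrite -eq_porbit_mem in ia; rewrite (eqP ia).
by move: ac abc cda ai ci di; rewrite /cyc_between; clear; lia.
Qed.

Lemma successor_clockwise_nc c : successor c -> clockwise_nc c.
Proof. by move=> hc i m; apply: contraLR => _; exact: hc. Qed.

Lemma successor_porbit c i : successor c -> porbit c i = setT.
Proof. by move=> hc; apply: porbit_cyc => // j; rewrite inE. Qed.

(** Only the images of [a] and [b] are exchanged, so the new arcs are the one from [a] to [y b] and
    its mirror case. Any other arc already contains the whole orbit of [y] through each of its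
    points. *)
Lemma clockwise_nc_split (y : 'S_n.+1) a b : clockwise_nc y -> a != b -> b \in porbit y a ->
  clockwise_nc (tperm a b * y)%g.
Proof.
suff key_arc a' b' : clockwise_nc y -> a' != b' -> b' \in porbit y a' ->
    forall m, cy a' m (y b') -> cy a' (y (tperm a' b' m)) (y b').
  move=> hy ab ba i m; rewrite !permM.
  case: tpermP => [->|->|/eqP ia /eqP ib].
  - exact: key_arc.
  - by rewrite tpermC; apply: key_arc; rewrite // 1?eq_sym 1?porbit_sym.
  - move=> h; case: tpermP => [e|e|_ _]; last exact: hy.
    + by apply: clockwise_nc_orbit h _ => //; rewrite e porbit_step.
    + by apply: clockwise_nc_orbit h _ => //; rewrite e porbit_step porbit_sym.
move=> {a b} hy; rename a' into a; rename b' into b; rewrite -keyE => ab ba m h.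
have pa k : k \in porbit y a -> porbit y k = porbit y a by rewrite -eq_porbit_mem => /eqP.
have ya : y a \in porbit y a by rewrite porbit_step porbit_id.
have yb : y b \in porbit y a by rewrite porbit_step.
have aa := porbit_id y a.
have yab : key (y a) != key (y b) by rewrite keyE (inj_eq perm_inj) -keyE.
case: tpermP => [e|e|/eqP ma /eqP mb].
- by move: h; rewrite e /cyc_between; lia.
- have h1 : ~~ cy a (y b) (y a) by apply: clockwise.
  have h2 : ~~ cy a b (y a) by apply: clockwise.
  have h3 : ~~ cy b a (y b) by apply: clockwise; rewrite ?pa.
  have h4 : ~~ cy b (y a) (y b) by apply: clockwise; rewrite ?pa.
  have h5 : key (y a) != key a.
    apply: contra ab; rewrite !keyE => /eqP yaa; move: ba => /porbitP [k ->].
    by elim: k => [|k /eqP IH]; rewrite ?perm1 // expgSr permM -IH yaa.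
  by move: h; rewrite e; move: h1 h2 h3 h4 h5 ab yab; rewrite /cyc_between; clear; lia.
apply: contraT => h1.
have yam : key (y m) != key (y b) by rewrite keyE (inj_eq perm_inj).
have [hc|hc] := boolP (cy m (y b) (y m)).
  have : cy m a (y m) by apply: clockwise_nc_orbit hc _ => //; rewrite pa.
  by move: h h1 yam hc; rewrite -keyE in ma; move: ma; rewrite /cyc_between; clear; lia.
by move: h h1 yam hc; rewrite /cyc_between; clear; lia.
Qed.

Lemma clockwise_nc_merge (x c : 'S_n.+1) : successor c -> clockwise_nc x -> x != c ->
  exists a b, [/\ b \notin porbit x a & clockwise_nc (tperm a b * x)%g].
Proof.
move=> hc hx xc.
have [a ha] : exists a, x a != c a.
  apply/existsP; apply: contraT; rewrite negb_exists => /forallP h.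
  by case/negP: xc; apply/eqP/permP => i; apply/eqP; rewrite -[_ == _]negbK h.
(* With this [b] the product sends [a] to [c a], so that the arc from [a] becomes empty. If [b] were
   in the orbit of [a], then [c a] would be an orbit element inside the arc from [a] to [x a]. *)
pose b := x^-1%g (c a); have xb : x b = c a by rewrite permKV.
have ca : forall m, ~~ cy a m (x b) by move=> m; rewrite xb; exact: hc.
rewrite -xb -keyE in ha.
have nba : b \notin porbit x a.
  rewrite -porbit_step; apply/negP => /(clockwise hx) h.
  have := ca (x a); move: ha h (ca a).
  have : key (x b) = key a -> key (x a) != key a -> False.
    by move=> e ne; have := ca (x a); rewrite /cyc_between e; lia.
  by rewrite /cyc_between; clear; lia.
have ab : key a != key b by rewrite keyE; apply: contraNneq nba => <-; exact: porbit_id.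
exists a, b; split=> // i m; rewrite !permM.
case: tpermP => [->|->|ia ib].
- by move=> h; have := ca m; rewrite h.
- move=> h; have caa := ca (x a).
  case: tpermP => [e|e|/eqP ma /eqP mb].
  + by move: h caa ha ab; rewrite e; have := ca b; rewrite /cyc_between; clear; lia.
  + by move: h; rewrite e /cyc_between; lia.
  apply: contraT => h1.
  have yam : key (x m) != key (x a) by rewrite keyE (inj_eq perm_inj).
  have xmb : key (x m) != key (x b) by rewrite keyE (inj_eq perm_inj).
  rewrite -!keyE in ma mb.
  have hxa : cy m (x a) (x m) by move: h h1 yam ma mb; rewrite /cyc_between; clear; lia.
  have hab : cy m a (x m).
    by apply: clockwise_nc_orbit hxa _ => //; rewrite porbit_sym porbit_step porbit_id.
  have hxb : cy m (x b) (x m).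
    by have := ca (x m); have := ca m; move: hab ma xmb; rewrite /cyc_between; clear; lia.
  have hb : cy m b (x m).
    by apply: clockwise_nc_orbit hxb _ => //; rewrite porbit_sym porbit_step porbit_id.
  by move: h h1 yam mb hb; rewrite /cyc_between; clear; lia.
move=> h; case: tpermP => [e|e|_ _]; last exact: hx.
  have xib : key (x i) != key (x b) by rewrite keyE (inj_eq perm_inj); apply/eqP.
  rewrite e in h; have := ca (x i); have := ca i; move: xib h.
  have : key i != key a by rewrite keyE; apply/eqP.
  by rewrite /cyc_between; clear; lia.
have h2 : cy i (x b) (x i) by rewrite e in h; exact: hx.
have h3 : cy i a (x i).
  move: h2; have := ca i; have := ca (x i).
  have : key i != key a by rewrite keyE; apply/eqP.
  have := ab.
  by rewrite /cyc_between; clear; lia.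
exact: hx.
Qed.

End CyclicOrder.

(** * The absolute order *)

Lemma perm_move2 n (i j a b : 'I_n.+1) : i != j -> a != b ->
  exists w : 'S_n.+1, w i = a /\ w j = b.
Proof.
move=> ij ab; pose u : 'S_n.+1 := tperm i a.
have ui : u i = a by exact: tpermL.
exists (u * tperm (u j) b)%g; rewrite !permM ui tpermL; split=> //.
by rewrite tpermD // 1?eq_sym // -ui (inj_eq perm_inj).
Qed.

Lemma reflectionsP n (t : 'S_n.+1) : 0 < n ->
  reflect (exists a b, a != b /\ t = tperm a b) (t \in reflections n).
Proof.
move=> n0; apply: (iffP imset2P) => [[w s _ /simplesP [a an ->] ->]|[a [b [ab ->]]]].
  exists (w (inord a)), (w (inord a.+1)); split; last exact: pconj_tperm.
  rewrite (inj_eq perm_inj) -val_eqE /= !inordK //; lia.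
have [|w [wa wb]] := @perm_move2 n (inord 0) (inord 1) a b _ ab.
  by rewrite -val_eqE /= !inordK.
exists w (adj_tperm n 0); rewrite ?inE ?adj_tperm_simples //.
by rewrite /adj_tperm pconj_tperm wa wb.
Qed.

Lemma pmulA m (u v w : 'S_m) : pmul u (pmul v w) = pmul (pmul u v) w.
Proof. by rewrite /pmul mulgA. Qed.

Definition ncyc m (w : 'S_m) : nat := #|porbits w|.

Lemma ncyc_mul_tperm n (x : 'S_n.+1) a b : a != b ->
  ncyc (tperm a b * x)%g + (b \notin porbit x a).*2 = (ncyc x).+1.
Proof. by move=> ab; have := porbits_mul_tperm x a b; rewrite /= ab addn1 porbit_sym. Qed.

Section AbsoluteOrder.

Variables (n : nat).
Hypothesis n_gt0 : 0 < n.

Lemma porbits_step (x t : 'S_n.+1) : t \in reflections n ->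
  (ncyc x) <= (ncyc (pmul x t)).+1 /\ (ncyc (pmul x t)) <= (ncyc x).+1.
Proof.
case/(reflectionsP _ n_gt0) => a [b [ab ->]]; have := ncyc_mul_tperm x ab.
by rewrite /pmul; case: (b \notin _); lia.
Qed.

Lemma porbits_wprod (x : 'S_n.+1) s : all (fun t => t \in reflections n) s ->
  (ncyc x) <= (ncyc (pmul x (wprod s))) + size s.
Proof.
elim: s x => [|t s IH] x; first by rewrite /pmul mul1g addn0.
rewrite wprod_cons; case/andP=> /(porbits_step x) [h _] /(IH (pmul x t)).
by rewrite pmulA /=; lia.
Qed.

Lemma porbits1 : (ncyc (1%g : 'S_n.+1)) = n.+1.
Proof.
rewrite /ncyc /porbits card_imset ?card_ord // => i j /eqP.
by rewrite eq_porbit_mem => /porbitP [k ->]; rewrite expg1n perm1.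
Qed.

Lemma porbits_word (w : 'S_n.+1) : exists s, [/\ all (fun t => t \in reflections n) s,
  wprod s = w & size s + (ncyc w) = n.+1].
Proof.
have bound (x : 'S_n.+1) : (ncyc x) <= n.+1.
  by rewrite /ncyc /porbits (leq_trans (leq_imset_card _ _)) ?card_ord.
have [N] := ubnP (n.+1 - (ncyc w)); elim: N w => // N IH w hN.
have [->|w1] := eqVneq w 1%g; first by exists [::]; rewrite porbits1.
have [a wa] : exists a, w a != a.
  apply/existsP; apply: contraT; rewrite negb_exists => /forallP h.
  by case/negP: w1; apply/eqP/permP => i; rewrite perm1; apply/eqP; rewrite -[_ == _]negbK h.
pose t : 'S_n.+1 := tperm a (w a).
have tR : t \in reflections n.
  by apply/(reflectionsP _ n_gt0); exists a, (w a); rewrite eq_sym.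
have aw : a != w a by rewrite eq_sym.
have := ncyc_mul_tperm w aw; rewrite porbit_step porbit_id addn0 => e.
have [|s [hs es sz]] := IH (pmul w t); first by have := bound (pmul w t); rewrite /pmul e; lia.
exists (rcons s t); split.
- by rewrite all_rcons tR.
- by rewrite wprod_rcons es /pmul mulgA tperm2 mul1g.
- by rewrite size_rcons; move: sz; rewrite /pmul e; lia.
Qed.

Lemma porbits_le_wprod s : all (fun t => t \in reflections n) s ->
  n.+1 <= (ncyc (wprod s)) + size s.
Proof.
by move/(porbits_wprod 1%g); rewrite porbits1 /pmul mulg1.
Qed.

Lemma ellTE (w : 'S_n.+1) : ellT w + (ncyc w) = n.+1.
Proof.
have [s [hs es sz]] := porbits_word w.
suff -> : ellT w = size s by [].
have pos_po : 0 < (ncyc w).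
  by apply/card_gt0P; exists (porbit w ord0); apply/imsetP; exists ord0.
apply: word_length_eq => //.
  (* The bounded search of [word_length] again: there is at least one cycle, so the word has at most
     [n] letters. *)
  rewrite card_Sn factS; apply: (@leq_trans n.+1);
    first by move: (leq_add (leqnn (size s)) pos_po); rewrite addn1 sz.
  by rewrite leq_pmulr ?fact_gt0.
by move=> s' hs' es'; have := porbits_le_wprod hs'; rewrite es' => le;
  rewrite -(leq_add2r (ncyc w)) sz addnC.
Qed.

Variable (key : 'I_n.+1 -> nat) (c : 'S_n.+1).
Hypothesis key_inj : injective key.
Hypothesis c_succ : successor key c.

Let porbits_c : (ncyc c) = 1.
Proof.
rewrite /ncyc /porbits (_ : [set porbit c i | i : 'I_n.+1] = [set setT]) ?cards1 //.
apply/setP => S; rewrite inE; apply/imsetP/eqP => [[i _ ->]|->].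
  exact: successor_porbit c_succ.
by exists ord0; rewrite ?(successor_porbit _ _ c_succ).
Qed.

(** The count forces every letter of [s] to merge two cycles; read backwards, each step splits
    one. *)
Lemma clockwise_nc_prefix (x : 'S_n.+1) s : all (fun t => t \in reflections n) s ->
  (ncyc x) = (ncyc (pmul x (wprod s))) + size s ->
  clockwise_nc key (pmul x (wprod s)) -> clockwise_nc key x.
Proof.
elim: s x => [|t s IH] x; first by rewrite /pmul mul1g.
rewrite wprod_cons pmulA [all _ _]/= => /andP [ht hs] sz hc.
have h3 := porbits_wprod (pmul x t) hs; have [h1 h2] := porbits_step x ht.
have sz' : ncyc (pmul x t) = ncyc (pmul (pmul x t) (wprod s)) + size s.
  by apply/eqP; rewrite eqn_leq h3 /= -ltnS -addnS -sz.
have {hc IH} hxt : clockwise_nc key (pmul x t) by exact: IH.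
have e2 : ncyc x = (ncyc (pmul x t)).+1 by rewrite sz' -addnS.
have [a [b [ab et]]] := reflectionsP _ n_gt0 ht.
have xE : x = (tperm a b * pmul x t)%g by rewrite /pmul et mulgA tperm2 mul1g.
rewrite xE; apply: clockwise_nc_split => //.
have := ncyc_mul_tperm (pmul x t) ab; rewrite -xE e2.
by case: (b \in porbit _ a) => //=; lia.
Qed.

Lemma clockwise_nc_word (x : 'S_n.+1) : clockwise_nc key x ->
  exists s, [/\ all (fun t => t \in reflections n) s, pmul x (wprod s) = c &
    (ncyc x) = (size s).+1].
Proof.
have [N] := ubnP (ncyc x); elim: N x => // N IH x hN hx.
have [->|xc] := eqVneq x c.
  by exists [::]; rewrite porbits_c /pmul mul1g.
have [a [b [ba hz]]] := clockwise_nc_merge key_inj c_succ hx xc.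
have ab : a != b by apply: contraNneq ba => <-; exact: porbit_id.
have := ncyc_mul_tperm x ab; rewrite ba /= => e.
have [|s [hs es sz]] := IH _ _ hz; first lia.
exists (tperm a b :: s); split=> /=.
- by rewrite hs andbT; apply/(reflectionsP _ n_gt0); exists a, b.
- by rewrite -es /pmul mulgA.
- by apply: succn_inj; rewrite -e sz /= addn2.
Qed.

Lemma NC_clockwise (x : 'S_n.+1) : x \in NC c <-> clockwise_nc key x.
Proof.
rewrite inE /leT; have ex := ellTE x; have ec := ellTE c; rewrite porbits_c in ec.
have ez := ellTE (pmul x^-1%g c).
have xz : pmul x (pmul x^-1%g c) = c by rewrite /pmul -mulgA mulVg mulg1.
split=> [/eqP e|hx].
  have [s [hs es sz]] := porbits_word (pmul x^-1%g c).
  apply: (clockwise_nc_prefix hs); rewrite es xz; last exact: successor_clockwise_nc.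
  by rewrite porbits_c; lia.
have [s [hs es sz]] := clockwise_nc_word hx.
have ws : wprod s = pmul x^-1%g c by rewrite -es /pmul -mulgA mulgV mulg1.
have h1 : ellT (pmul x^-1%g c) <= size s by exact: word_length_le hs ws.
have [s' [hs' es' sz']] := porbits_word (pmul x^-1%g c).
have := porbits_wprod x hs'; rewrite es' xz porbits_c.
have -> : size s' = ellT (pmul x^-1%g c).
  by apply/eqP; rewrite -(eqn_add2r (ncyc (pmul x^-1%g c))) sz' ez.
have {}h1 : ellT (pmul x^-1%g c) < ncyc x by rewrite sz ltnS.
by move=> h2; apply/eqP; move: h1 h2 ex ec; clear; lia.
Qed.

End AbsoluteOrder.

(** * The cyclic order of a Coxeter element *)

Section CoxeterKey.

Variables (n : nat) (cu : seq nat).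
Hypothesis n_gt0 : 0 < n.
Hypothesis cuP : perm_eq cu (iota 0 n).

Definition label_key (i : 'I_n.+1) : nat := circle_key n (tau cu) i.

Local Notation key := label_key.
Let c : 'S_n.+1 := wprod (map (adj_tperm n) cu).

Lemma label_key_inj : injective key.
Proof.
move=> i j; rewrite /key; have := circle_keyP n (tau cu) i; have := circle_keyP n (tau cu) j.
have := ltn_ord i; have := ltn_ord j => hj hi hkj hki e; apply: val_inj => /=.
by move: hj hi hkj hki e; clear; lia.
Qed.

Lemma coxeter_successor : successor key c.
Proof.
have mem_cu k : k < n -> k \in cu by move=> kn; rewrite (perm_mem cuP) mem_iota.
have all_linked p q : p <= n -> q <= n -> linked cu p q.
  by move=> pn qn k hk; apply: mem_cu; lia.
have cu_uniq : uniq cu by rewrite (perm_uniq cuP) iota_uniq.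
have cu_lt : all (fun k => k < n) cu.
  by apply/allP => k; rewrite (perm_mem cuP) mem_iota.
move=> i m; have [_ h] := adjacent_prod_cyc cu_uniq cu_lt
   (fun _ _ _ _ => erefl) (leq_ord i).
have := h m (leq_ord m) (all_linked _ _ (leq_ord i) (leq_ord m)).
by rewrite /nat_app inord_val.
Qed.

Let x m := iter m c ord0.

Let cycle_uniq : uniq (cycle_seq c).
Proof.
have := uniq_traject_porbit c ord0.
by rewrite (successor_porbit label_key_inj _ coxeter_successor) cardsT card_ord.
Qed.

Let index_iter m : m <= n -> index (x m) (cycle_seq c) = m.
Proof.
move=> mn; rewrite /x -(nth_traject (n := n.+1) c) // index_uniq //.
by rewrite size_traject.
Qed.

Let iterE (i : 'I_n.+1) : exists2 m, m <= n & i = x m.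
Proof.
have : i \in porbit c ord0 by rewrite (successor_porbit label_key_inj _ coxeter_successor) inE.
rewrite porbit_traject (successor_porbit label_key_inj _ coxeter_successor) cardsT card_ord.
by case/trajectP => m mn ->; exists m.
Qed.

(** For the label 0, [tau] compares an index with itself and is false: the top point gets the
    largest key, and the cycle starting there meets the other keys in increasing order. *)
Let key_ord0 : key ord0 = n.*2.
Proof. by rewrite /key /circle_key /tau ltnn subn0. Qed.

Let key_max : key ord_max = n.
Proof. by rewrite /key /circle_key /=; case: ifP => // _; lia. Qed.

Let key_step m : 0 < m -> m < n -> key (x m) < key (x m.+1).
Proof.
move=> m0 mn; have := coxeter_successor (x m) ord0; rewrite -/(x m.+1) key_ord0.
have ne k : 0 < k -> k <= n -> key (x k) < n.*2.
  move=> k0 kn; have := circle_keyP n (tau cu) (x k); rewrite -/(key _).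
  suff : x k != ord0 by rewrite -val_eqE /=; move: (ltn_ord (x k)); clear; lia.
  apply: contraTneq k0 => e; have := index_iter kn; rewrite e.
  by rewrite -[ord0]/(x 0) index_iter // => <-.
have := ne _ m0 (ltnW mn); have := ne m.+1 isT mn.
by rewrite -[c _]/(x m.+1) /cyc_between; clear; lia.
Qed.

Let key_mono m m' : 0 < m -> m <= m' -> m' <= n -> key (x m) <= key (x m').
Proof.
move=> m0; elim: m' => [|m' IH]; first by lia.
rewrite leq_eqVlt => /orP [/eqP <- //|lt] mn.
by apply: leq_trans (IH _ _) (ltnW (key_step _ _)); lia.
Qed.

(** The bottom point has key [n] on either side. Keys on the right are smaller, and keys increase
    along the cycle, so [i] comes before the bottom point. *)
Lemma tau_Rc (i : 'I_n.+1) : i != ord0 -> i != ord_max -> tau cu i -> i \in Rc c.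
Proof.
move=> i0 imax t; have [m mn em] := iterE i; have [M Mn eM] := iterE ord_max.
have lt : m < M.
  rewrite ltnNge; apply/negP => le.
  have M0 : 0 < M.
    by rewrite lt0n; apply/eqP => e; move: eM n_gt0; rewrite e => /(congr1 val) /= ->.
  have := key_mono M0 le mn; rewrite -em -eM key_max /key /circle_key t.
  by move: (ltn_ord i) imax; rewrite -val_eqE /=; clear; lia.
rewrite /Rc eM index_iter //; apply/(nthP ord0); exists m.
  by rewrite size_take size_traject; case: ifP => _; lia.
by rewrite nth_take ?nth_traject //; lia.
Qed.

Lemma tau_Lc (i : 'I_n.+1) : i != ord0 -> i != ord_max -> ~~ tau cu i -> i \in Lc c.
Proof.
move=> i0 imax t; have [m mn em] := iterE i; have [M Mn eM] := iterE ord_max.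
have lt : M <= m.
  rewrite leqNgt; apply/negP => lt.
  have m0 : 0 < m by rewrite lt0n; apply: contraNneq i0 => e; rewrite em e.
  have := key_mono m0 (ltnW lt) Mn; rewrite -em -eM key_max /key /circle_key (negPf t).
  by move: (ltn_ord i) imax; rewrite -val_eqE /=; clear; lia.
rewrite /Lc eM index_iter // mem_rcons inE; apply/orP; right.
apply/(nthP ord0); exists (m - M).
  by rewrite size_drop size_traject; lia.
by rewrite nth_drop subnKC // nth_traject.
Qed.

End CoxeterKey.

(** * Reading's map on aligned permutations *)

(** If [y] is filtered out, its index becomes the length of the filtered list, which still exceeds
    the index of [x]. *)
Lemma index_filter_lt (T : eqType) (P : pred T) (s : seq T) x y : P x ->
  index x s < index y s -> index x (filter P s) < index y (filter P s).
Proof.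
move=> Px; elim: s => //= a s IH.
have [->|ax] := eqVneq a x.
  by rewrite Px /= eqxx; case: eqP.
case: eqP => // ay; rewrite ltnS => /IH lt.
by case: ifP => //= _; rewrite (negPf ax); case: eqP.
Qed.

(** Lengths were computed under left multiplication, which acts on labels; [Cov] multiplies on the
    right, and passing to inverses transfers the count. *)
Lemma card_InvV n (w : 'S_n.+1) : #|Inv w^-1%g| = #|Inv w|.
Proof.
pose f (u : 'S_n.+1) (p : 'I_n.+1 * 'I_n.+1) := (u p.2, u p.1).
have fK u : cancel (f u) (f u^-1%g) by case=> i k; rewrite /f /= !permK.
suff sub u : f u^-1%g @: Inv u \subset Inv u^-1%g.
  apply/eqP; rewrite eqn_leq.
  have h1 := subset_leq_card (sub w); have h2 := subset_leq_card (sub w^-1%g).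
  rewrite card_imset in h1; last exact: can_inj (fK _).
  by rewrite card_imset in h2; [rewrite invgK in h2; rewrite h1 h2|exact: can_inj (fK _)].
apply/subsetP => p /imsetP [[i k]]; rewrite !inE !pos_ord /= => /andP [ik h] ->.
by rewrite /f /= h !invgK !permKV.
Qed.

Lemma wprod_pconj m (w : 'S_m) s : wprod (map (pconj w) s) = pconj w (wprod s).
Proof.
elim: s => [|t s IH] /=; first by rewrite pconjJ conj1g.
by rewrite IH /pmul !pconjJ conjMg.
Qed.

Definition descents n (w : 'S_n.+1) : seq nat :=
  [seq p <- iota 0 n | nat_app w p.+1 < nat_app w p].

Lemma mem_descents n (w : 'S_n.+1) p :
  (p \in descents w) = (p < n) && (nat_app w p.+1 < nat_app w p).
Proof. by rewrite mem_filter mem_iota andbC. Qed.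

Lemma descents_linked n (w : 'S_n.+1) p q : p < q -> q <= n -> linked (descents w) p q ->
  nat_app w q < nat_app w p.
Proof.
elim: q => // q IH; rewrite ltnS leq_eqVlt => pq qn h.
have hq : nat_app w q.+1 < nat_app w q.
  by have := h q ltac:(lia); rewrite mem_descents => /andP [].
case/orP: pq => [/eqP -> //|pq]; apply: ltn_trans hq _; apply: IH => //; first exact: ltnW.
by move=> k hk; apply: h; lia.
Qed.

Lemma CovP n (w : 'S_n.+1) t :
  reflect (exists2 p, p \in descents w & t = pconj w (adj_tperm n p)) (t \in Cov w).
Proof.
have ellE p : p < n -> (ellS (pmul w (adj_tperm n p)) < ellS w) = (nat_app w p.+1 < nat_app w p).
  move=> pn; rewrite !ellSE -(card_InvV w) -(card_InvV (pmul _ _)).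
  have -> : ((pmul w (adj_tperm n p))^-1 = lmul p w^-1)%g by rewrite /lmul /pmul invMg tpermV.
  have dE : desc w^-1%g p = (nat_app w p.+1 < nat_app w p) by rewrite /desc /pos invgK.
  by rewrite -dE; case: (boolP (desc _ _)) => d;
    [rewrite (Inv_lmul_desc pn d) | rewrite (Inv_lmul pn d)]; lia.
apply: (iffP imsetP) => [[s]|[p pd ->]].
  rewrite inE => /andP [/simplesP [p pn ->]]; rewrite ellE // => h ->.
  by exists p; rewrite // mem_descents pn.
move: pd; rewrite mem_descents => /andP [pn h].
by exists (adj_tperm n p); rewrite // inE adj_tperm_simples // ellE.
Qed.

Definition same_run n (w : 'S_n.+1) (i j : 'I_n.+1) : Prop :=
  linked (descents w) (pos w i) (pos w j).

Section ReadAligned.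

Variables (n : nat) (cu : seq nat).
Hypothesis n_gt0 : 0 < n.
Hypothesis cuP : perm_eq cu (iota 0 n).
Variable w : 'S_n.+1.
Hypothesis w_al : aligned cu w.

Local Notation R := (Read (map (adj_tperm n) cu) w).
Local Notation key := (label_key cu).

Let g p := pconj w (adj_tperm n p).

Let g_inj p q : p < n -> q < n -> g p = g q -> p = q.
Proof. by move=> pn qn /pconj_inj /adj_tperm_inj; apply. Qed.

Let gE p : p < n -> g p = nat_tperm n (nat_app w p.+1) (nat_app w p).
Proof.
move=> pn; rewrite /g /adj_tperm pconj_tperm tpermC /nat_tperm /nat_app.
by congr tperm; apply: val_inj; rewrite /= inordK // ltn_ord.
Qed.

Let pos_ap p : p <= n -> pos w (nat_app w p) = p.
Proof. by move=> pn; rewrite /nat_app pos_perm inordK. Qed.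

(** [e] lists the descent positions in the order of their cover reflections [g p]. For consecutive
    descents [p.-1] and [p], the inversion order is applied with the label at [p] as middle label:
    on the right, [g p] comes before [g p.-1], hence the negation. *)
Lemma Read_word : exists e, [/\ uniq e, e =i descents w,
  R = pconj w (wprod (map (adj_tperm n) e)) &
  forall p, 0 < p -> p.-1 \in e -> p \in e -> ~~ tau cu (nat_app w p) = tau e p].
Proof.
have [v [hv wv _ /(_ w_al) ord]] := sorting_word_aligned n_gt0 cuP w.
pose flt := [seq t <- inv_word n v | t \in Cov w].
have RE : R = wprod flt by rewrite /Read wv.
have flt_uniq : uniq flt by rewrite filter_uniq // (inv_word_uniq hv).
pose idx (t : 'S_n.+1) := find (fun p => g p == t) (iota 0 n).
have idxE p : p < n -> idx (g p) = p.
  move=> pn; have h : has (fun q => g q == g p) (iota 0 n).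
    by apply/hasP; exists p; rewrite ?mem_iota.
  have lt : idx (g p) < n by move: h; rewrite has_find size_iota.
  by have := nth_find 0 h; rewrite nth_iota // add0n => /eqP /g_inj; apply.
pose e := map idx flt.
have mem_flt t : t \in flt -> exists2 p, p \in descents w & t = g p.
  by rewrite mem_filter => /andP [/CovP].
have fltE : map g e = flt.
  rewrite -map_comp -[RHS]map_id; apply/eq_in_map => t /mem_flt [p].
  by rewrite mem_descents => /andP [pn _] -> /=; rewrite idxE.
have eE : e =i descents w.
  move=> p; apply/mapP/idP => [[t /mem_flt [q qd ->]] ->|pd].
    by move: (qd); rewrite mem_descents => /andP [qn _]; rewrite idxE.
  move: (pd); rewrite mem_descents => /andP [pn h].
  exists (g p); last by rewrite idxE.
  rewrite mem_filter; apply/andP; split; first by apply/CovP; exists p.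
  apply/(inv_wordP _ hv); exists (nat_app w p.+1), (nat_app w p); split=> //; last exact: gE.
    exact: nat_app_le.
  by rewrite !pos_ap //; lia.
have idx_flt p : p \in e -> index p e = index (g p) flt.
  move=> pe; have -> : g p = nth (g 0) flt (index p e).
    by rewrite -fltE (nth_map 0) ?index_mem // nth_index.
  by rewrite index_uniq // -fltE size_map index_mem.
exists e; split=> //.
- by apply: (@map_uniq _ _ g); rewrite fltE.
- by rewrite RE -fltE -wprod_pconj -[in RHS]map_comp.
move=> p p0 pe' pe.
move: (pe') (pe); rewrite !eE !mem_descents prednK // => /andP [pn' h'] /andP [pn h].
have := ord (nat_app w p.+1) (nat_app w p) (nat_app w p.-1) h h' (nat_app_le _ _).
rewrite !pos_ap; [|lia..]; rewrite -gE //.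
have -> : nat_tperm n (nat_app w p) (nat_app w p.-1) = g p.-1 by rewrite gE // prednK.
rewrite /tau !idx_flt // => /(_ ltac:(lia) ltac:(lia)).
have cov q : q \in e -> g q \in Cov w by rewrite eE => qd; apply/CovP; exists q.
case: ifP => _ /(index_filter_lt (P := mem (Cov w))) lt.
  by rewrite ltnNge ltnW // lt //; exact: cov.
by rewrite lt //; exact: cov.
Qed.

(* Positions increase along a run while labels decrease, so that reading the
   positions in the order of [circle_key] is the same cyclic order as [label_key]. *)
Lemma Read_succ i : same_run w i (R i) /\
  forall m, same_run w i m -> ~~ cyc_between (key i) (key m) (key (R i)).
Proof.
have [e [ue eE RE ht]] := Read_word.
have le_lt : all (fun k => k < n) e.
  by apply/allP => k; rewrite eE mem_descents => /andP [].
have lE p q : linked e p q <-> linked (descents w) p q.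
  by split=> h k hk; have := h k hk; rewrite eE.
(* Reversing heights and exchanging sides is a half-turn of the circle, so the clockwise orientation
   is kept. *)
set t := fun p => ~~ tau cu (nat_app w p).
pose y := wprod (map (adj_tperm n) e).
have [h1 h2] := adjacent_prod_cyc (t := t) ue le_lt ht (pos_le w i).
have pos_eq (j : 'I_n.+1) : inord (pos w j) = w^-1%g j by rewrite pos_ord inord_val.
have ap_pos (j : 'I_n.+1) : nat_app w (pos w j) = j by rewrite /nat_app pos_eq permKV.
have yE : nat_app y (pos w i) = pos w (R i).
  have -> : R i = w (y (w^-1%g i)) by rewrite RE pconjJ -{1}(permKV w i) permJ.
  by rewrite /nat_app pos_eq pos_perm.
rewrite -/y yE in h1 h2; split; first exact/lE.
move=> m im; have := h2 _ (pos_le w m) ((lE _ _).2 im).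
move/lE: h1 => h1.
have mono (a b : 'I_n.+1) : same_run w a b -> pos w a < pos w b -> b < a.
  by move=> h lt; have := descents_linked lt (pos_le w b) h; rewrite !ap_pos.
have neq (a b : 'I_n.+1) : a = b :> nat <-> pos w a = pos w b.
  split=> [/val_inj -> //|h]; have := pos_inj (leq_ord a) (leq_ord b) h; done.
have cmp (a b : 'I_n.+1) : same_run w a b -> (pos w a < pos w b) = (b < a).
  move=> h; apply/idP/idP; first exact: mono.
  move=> lt; rewrite ltnNge leq_eqVlt; apply/negP => /orP [/eqP /(neq b a).2|]; first lia.
  by move/(mono _ _ (linked_sym h)); lia.
have hmr : same_run w m (R i) := linked_trans (linked_sym im) h1.
have := cmp _ _ im; have := cmp _ _ h1; have := cmp _ _ hmr.
have := cmp _ _ (linked_sym im); have := cmp _ _ (linked_sym h1).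
have := cmp _ _ (linked_sym hmr).
rewrite /label_key /circle_key /t !ap_pos.
have := pos_le w i; have := pos_le w m; have := pos_le w (R i).
have := leq_ord i; have := leq_ord m; have := leq_ord (R i).
move: (pos w i) (pos w m) (pos w (R i)) (nat_of_ord i) (nat_of_ord m) (nat_of_ord (R i)).
rewrite /cyc_between => a b d i' m' r'.
have te x z : x = z -> tau cu x = tau cu z by move=> ->.
move: (te i' m') (te i' r') (te m' r').
by case: (tau cu i'); case: (tau cu m'); case: (tau cu r') => /=; clear; lia.
Qed.

End ReadAligned.

(** * Descending runs of an aligned permutation *)

(* Induction on the distance of k and i in w: the label following k either gives
   two shorter inversions or a triple to which alignment applies. *)
Lemma aligned_incl n u (w w' : 'S_n.+1) : aligned u w -> aligned u w' ->
  (forall p, p \in descents w -> pos w' (nat_app w p) < pos w' (nat_app w p.+1)) ->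
  forall i k, i < k -> k <= n -> pos w k < pos w i -> pos w' k < pos w' i.
Proof.
move=> [_ al] [_ al'] hd.
have ap_pos v : v <= n -> nat_app w (pos w v) = v.
  by move=> vn; rewrite /nat_app /pos inord_val permKV inordK.
have pos_ap p : p <= n -> pos w (nat_app w p) = p by move=> pn; rewrite /nat_app pos_perm inordK.
move=> i k; have [d] := ubnP (pos w i - pos w k); elim: d i k => // d IH i k hd' ik kn h.
have iN : i <= n by lia.
have hin := pos_le w i; have hkn : (pos w k).+1 <= n by lia.
set m := nat_app w (pos w k).+1; have mn : m <= n by exact: nat_app_le.
have pm : pos w m = (pos w k).+1 by rewrite pos_ap.
have dk : m < k -> pos w' k < pos w' m.
  move=> mk; have := hd (pos w k); rewrite mem_descents (ap_pos k kn) -/m; apply.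
  by rewrite mk andbT.
have mk : m <> k by move=> e; rewrite e in pm; lia.
have [e|mi] := eqVneq m i; first by rewrite -e; apply: dk; rewrite e.
have pmi : pos w m != pos w i by apply: contraNneq mi => /(pos_inj mn iN) ->.
have [lt|gt] := ltnP m k.
  have [im|mi'] := ltnP i m.
    by apply: ltn_trans (dk lt) _; apply: IH => //; lia.
  have mi2 : m < i by lia.
  have := al m i k mi2 ik kn; have := al' m i k mi2 ik kn (dk lt).
  by case: (tau u i); lia.
have km : k < m by lia.
have him : pos w m < pos w i by lia.
have := al i k m ik km mn him.
have := al' i k m ik km mn (IH i m ltac:(lia) ltac:(lia) mn him).
by case: (tau u k) => //; lia.
Qed.

Lemma aligned_eq n u (w w' : 'S_n.+1) : aligned u w -> aligned u w' ->
  (forall p, p \in descents w -> pos w' (nat_app w p) < pos w' (nat_app w p.+1)) ->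
  (forall p, p \in descents w' -> pos w (nat_app w' p) < pos w (nat_app w' p.+1)) -> w = w'.
Proof.
move=> al al' h h'.
have i1 := aligned_incl al al' h; have i2 := aligned_incl al' al h'.
suff : (w' * w^-1 = 1)%g by move/eqP; rewrite mulg_eq1 => /eqP ->; rewrite invgK.
(* A descent here means that the labels at places [p] and [p.+1] of [w] occur in the opposite order
   in [w'], which contradicts one of the two inclusions of inversions. *)
apply: nodesc_eq1 => p pn; rewrite /desc /pos invMg invgK !permM; apply/negP => lt.
have E (z : 'S_n.+1) q : pos z (nat_app w q) = z^-1%g (w (inord q)) by rewrite pos_ord.
have pE q : q <= n -> pos w (nat_app w q) = q by move=> qn; rewrite E permK inordK.
case: (ltngtP (nat_app w p) (nat_app w p.+1)) => [c|c|/val_inj/perm_inj/(congr1 val)] /=.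
- have := i2 _ _ c (nat_app_le _ _); rewrite !E in lt *; move=> /(_ lt).
  by rewrite -!E !pE //; lia.
- have := i1 _ _ c (nat_app_le _ _); rewrite !pE //; last exact: ltnW.
  by move/(_ (ltnSn p)); rewrite !E ltnNge ltnW.
- by rewrite !inordK //; [move/n_Sn|exact: ltnW].
Qed.

Lemma same_run_lt n (w : 'S_n.+1) (i j : 'I_n.+1) : same_run w i j -> i < j -> pos w j < pos w i.
Proof.
move=> h lt; rewrite ltnNge leq_eqVlt; apply/negP => /orP [/eqP e|lt'].
  by have := pos_inj (leq_ord i) (leq_ord j) e; lia.
have := descents_linked lt' (pos_le w j) h.
by rewrite /nat_app /pos !inord_val !permKV; lia.
Qed.

Section RunsNoncrossing.

Variables (n : nat) (cu : seq nat).
Hypothesis n_gt0 : 0 < n.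
Hypothesis cuP : perm_eq cu (iota 0 n).
Variable w : 'S_n.+1.
Hypothesis w_al : aligned cu w.

Local Notation R := (Read (map (adj_tperm n) cu) w).
Local Notation key := (label_key cu).

Lemma Read_porbit i j : j \in porbit R i <-> same_run w i j.
Proof.
pose S := [set j | `[< same_run w i j >]].
have mS k : k \in S <-> same_run w i k by rewrite inE; split=> [/asboolP|/asboolP].
rewrite -mS (porbit_cyc (@label_key_inj n cu) (S := S)) //.
- move=> k /mS ik; apply/mS; apply: linked_trans ik _.
  by case: (Read_succ n_gt0 cuP w_al k).
- move=> k m /mS ik /mS im; apply: (Read_succ n_gt0 cuP w_al k).2.
  exact: linked_trans (linked_sym ik) im.
- by apply/mS; exact: linked_refl.
Qed.

Let side lo hi (j : nat) : lo < j -> j < hi -> hi <= n -> pos w hi < pos w lo ->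
  if tau cu j then pos w j < pos w lo else pos w hi < pos w j.
Proof. by case: w_al => _ al; exact: al. Qed.

(** Alignment puts a label of the later run on the left if its value lies between [a] and [c], and a
    label of the earlier run on the right if its value lies between [b] and [d]. No choice of sides
    then allows the chords to cross. *)
Lemma runs_cross_before (a b c d : 'I_n.+1) : a != c ->
  cyc_between (key a) (key b) (key c) -> cyc_between (key c) (key d) (key a) ->
  same_run w a c -> same_run w b d ->
  pos w a < pos w b -> pos w a < pos w d -> pos w c < pos w b -> pos w c < pos w d -> False.
Proof.
move=> ac h1 h2 rac rbd pab pad pcb pcd.
have Q (lo hi : 'I_n.+1) (q : 'I_n.+1) : same_run w lo hi -> pos w lo < pos w q ->
    lo < q < hi -> ~~ tau cu q.
  move=> r lt /andP [l1 l2]; have := side l1 l2 (leq_ord hi).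
  by move/(_ (same_run_lt r (ltn_trans l1 l2))); case: (tau cu q) => //; lia.
have P (lo hi : 'I_n.+1) (p : 'I_n.+1) : same_run w lo hi -> pos w p < pos w hi ->
    lo < p < hi -> tau cu p.
  move=> r lt /andP [l1 l2]; have := side l1 l2 (leq_ord hi).
  by move/(_ (same_run_lt r (ltn_trans l1 l2))); case: (tau cu p) => //; lia.
have rca := linked_sym rac; have rdb := linked_sym rbd.
have := Q a c b rac pab; have := Q a c d rac pad; have := Q c a b rca pcb.
have := Q c a d rca pcd; have := P b d a rbd pad; have := P b d c rbd pcd.
have := P d b a rdb pab; have := P d b c rdb pcb; move: h1 h2.
have := ltn_ord a; have := ltn_ord b; have := ltn_ord c; have := ltn_ord d.
have ac' : nat_of_ord a <> c by move/val_inj => e; rewrite e eqxx in ac.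
have te (x y : 'I_n.+1) : x = y :> nat -> tau cu x = tau cu y by move=> ->.
move: ac' (te a b) (te b c) (te c d) (te d a) (te b d);
  rewrite /label_key /circle_key /cyc_between; clear.
case: (tau cu a); case: (tau cu b); case: (tau cu c); case: (tau cu d) => /=; lia.
Qed.

(** Runs are intervals of positions, so of two different runs one lies entirely before the other. *)
Lemma runs_noncrossing (a b c d : 'I_n.+1) : a != c ->
  cyc_between (key a) (key b) (key c) -> cyc_between (key c) (key d) (key a) ->
  same_run w a c -> same_run w b d -> same_run w a b.
Proof.
move=> ac h1 h2 rac rbd; apply: contrapT => nab.
have between (x y z : 'I_n.+1) : same_run w x y ->
    (pos w x <= pos w z <= pos w y) || (pos w y <= pos w z <= pos w x) -> same_run w x z.
  by move=> h hz k hk; apply: h; lia.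
have trans := @linked_trans (descents w).
have sy := @linked_sym (descents w).
have n1 := between _ _ b rac; have n2 := between _ _ d rac.
have n3 := between _ _ a rbd; have n4 := between _ _ c rbd.
have {n1}n1 : ~~ ((pos w a <= pos w b <= pos w c) || (pos w c <= pos w b <= pos w a)).
  by apply/negP => /n1 /nab.
have {n2}n2 : ~~ ((pos w a <= pos w d <= pos w c) || (pos w c <= pos w d <= pos w a)).
  by apply/negP => /n2 h; apply: nab; apply: trans h _; exact: sy.
have {n3}n3 : ~~ ((pos w b <= pos w a <= pos w d) || (pos w d <= pos w a <= pos w b)).
  by apply/negP => /n3 h; apply: nab; exact: sy.
have {n4}n4 : ~~ ((pos w b <= pos w c <= pos w d) || (pos w d <= pos w c <= pos w b)).
  by apply/negP => /n4 h; apply: nab; apply: trans rac _; exact: sy.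
have : (pos w a < pos w b) && (pos w a < pos w d) && (pos w c < pos w b) && (pos w c < pos w d)
  || (pos w b < pos w a) && (pos w d < pos w a) && (pos w b < pos w c) && (pos w d < pos w c).
  by move: n1 n2 n3 n4; clear; lia.
case/orP=> /andP [/andP [/andP [p1 p2] p3] p4].
  exact: (runs_cross_before ac h1 h2 rac rbd).
have kac : key a != key c by rewrite (inj_eq (@label_key_inj n cu)).
have bd : b != d.
  by apply/eqP => e; move: h1 h2 kac; rewrite -e /cyc_between; clear; lia.
apply: (runs_cross_before bd _ _ rbd (sy _ _ rac)) => //.
  by move: h1 h2 kac; rewrite /cyc_between; clear; lia.
by move: h1 h2 kac; rewrite /cyc_between; clear; lia.
Qed.

Lemma Read_clockwise_nc : clockwise_nc key R.
Proof.
move=> i m h; have succ := Read_succ n_gt0 cuP w_al.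
have nim : ~ same_run w i m by move=> r; have := (succ i).2 m r; rewrite h.
have keyE a b : (key a == key b) = (a == b) by apply: inj_eq; exact: label_key_inj.
have im : key (R i) != key (R m).
  by rewrite keyE (inj_eq perm_inj); apply/eqP => e; apply: nim; rewrite e; exact: linked_refl.
have iRm : key i != key (R m).
  by rewrite keyE; apply/eqP => e; apply: nim; rewrite {1}e; exact: linked_sym (succ m).1.
apply: contraT => h'; case: nim.
apply: (@runs_noncrossing i m (R i) (R m)) => //.
- rewrite -keyE; apply/eqP => e; move: h' iRm; rewrite -e /cyc_between; clear; lia.
- by move: h' iRm im; rewrite /cyc_between; clear; lia.
- exact: (succ i).1.
- exact: (succ m).1.
Qed.

End RunsNoncrossing.

(** * Polygons in the circle *)

Section Extremes.

Variable n : nat.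
Implicit Types S : {set 'I_n.+1}.

Definition min_vertex S : 'I_n.+1 := [arg min_(i < odflt ord0 [pick i in S] | i \in S) (i : nat)].
Definition max_vertex S : 'I_n.+1 := [arg max_(i > odflt ord0 [pick i in S] | i \in S) (i : nat)].

Lemma pick_in S i : i \in S -> odflt ord0 [pick j in S] \in S.
Proof. by move=> iS; case: pickP => [//|/(_ i)]; rewrite iS. Qed.

Lemma min_vertexP S i : i \in S -> min_vertex S \in S /\ min_vertex S <= i.
Proof.
move=> iS; rewrite /min_vertex; case: arg_minnP; first exact: pick_in iS.
by move=> j jS h; split=> //; exact: h.
Qed.

Lemma max_vertexP S i : i \in S -> max_vertex S \in S /\ i <= max_vertex S.
Proof.
move=> iS; rewrite /max_vertex; case: arg_maxnP; first exact: pick_in iS.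
by move=> j jS h; split=> //; exact: h.
Qed.

Lemma max_labelE S i : i \in S -> max_label S = max_vertex S.
Proof.
move=> /max_vertexP [mS _]; apply/eqP; rewrite eqn_leq /max_label leq_bigmax_cond // andbT.
by apply/bigmax_leqP => j /max_vertexP [].
Qed.

End Extremes.

Section Leftness.

Variables (n : nat) (t : nat -> bool).
Implicit Types P Q : {set 'I_n.+1}.

Local Notation key i := (circle_key n t (nat_of_ord i)).

Definition uncrossed P Q : Prop := forall a b c d : 'I_n.+1,
  a \in P -> b \in Q -> c \in P -> d \in Q -> a != c ->
  cyc_between (key a) (key b) (key c) -> ~~ cyc_between (key c) (key d) (key a).

(** When the height ranges of two disjoint polygons overlap, the highest vertex of one lies within
    the range of the other; the side of the circle on which this vertex lies decides. *)
Definition left_of P Q : bool :=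
  (min_vertex P < min_vertex Q < max_vertex P) && t (min_vertex Q) ||
    (min_vertex Q < min_vertex P < max_vertex Q) && ~~ t (min_vertex P).

Lemma left_of_asym P Q : left_of P Q -> ~~ left_of Q P.
Proof. by rewrite /left_of; case: (t (min_vertex P)); case: (t (min_vertex Q)); lia. Qed.

(** The chord from the highest to the lowest vertex of [P] does not separate vertices of [Q], so any
    vertex of [Q] at a height within [P] may replace the highest vertex used in [left_of]. *)
Lemma straddle P Q (j : 'I_n.+1) : uncrossed P Q -> [disjoint P & Q] ->
  min_vertex P \in P -> j \in Q ->
  min_vertex P < j < max_vertex P -> if t j then left_of P Q else left_of Q P.
Proof.
move=> nc dis p1P jQ pj; have [_ p2P] := max_vertexP p1P; have [q1Q q1j] := min_vertexP jQ.
have [q2Q q2j] := max_vertexP jQ; have {p2P} p2P : max_vertex P \in P by case: (max_vertexP p1P).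
have ne (a b : 'I_n.+1) : a \in P -> b \in Q -> nat_of_ord a <> b.
  by move=> aP bQ /val_inj e; move: bQ; rewrite -e (disjointFr dis aP).
have te (x y : 'I_n.+1) : x = y :> nat -> t x = t y by move=> ->.
have pp : min_vertex P != max_vertex P by rewrite -val_eqE /=; lia.
have K1 := circle_keyP n t (min_vertex P); have K2 := circle_keyP n t (max_vertex P);
  have Q1 := circle_keyP n t (min_vertex Q).
have Kt (i : 'I_n.+1) : t i -> key i = i by rewrite /circle_key => ->.
have Kf (i : 'I_n.+1) : ~~ t i -> key i = n.*2 - i by rewrite /circle_key => /negPf ->.
have b1 := ltn_ord (max_vertex P); have b2 := ltn_ord j; have p1q1 := ne _ _ p1P q1Q.
case/andP: pj => pj jp.
have cross b d : b \in Q -> d \in Q ->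
  cyc_between (key (min_vertex P)) (key b) (key (max_vertex P)) ->
    cyc_between (key (max_vertex P)) (key d) (key (min_vertex P)) -> False.
  by move=> bQ dQ c1 c2; have := nc _ _ _ _ p1P bQ p2P dQ pp c1; rewrite c2.
have [lt|le] := ltnP (min_vertex P) (min_vertex Q).
  have tq : t (min_vertex Q) = t j.
    have [e|q1j'] := eqVneq (nat_of_ord (min_vertex Q)) j; first by rewrite e.
    apply/idP/idP => h; apply: contraT => h'.
      case: (cross _ _ q1Q jQ); rewrite ?(Kt _ h) ?(Kf _ h') /cyc_between;
      by move: K1 K2 lt q1j q1j' pj jp b1 b2; clear; lia.
    case: (cross _ _ jQ q1Q); rewrite ?(Kt _ h) ?(Kf _ h') /cyc_between;
    by move: K1 K2 lt q1j q1j' pj jp b1 b2; clear; lia.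
  rewrite /left_of tq; case: (t j) => /=; rewrite ?andbT ?andbF ?orbF /=;
  by move: lt q1j jp; clear; lia.
have lt : min_vertex Q < min_vertex P by move: le p1q1; clear; lia.
have tp : t (min_vertex P) != t j.
  apply/negP => /eqP e; case: (boolP (t j)) => h.
    rewrite h in e.
    case: (cross _ _ jQ q1Q); rewrite ?(Kt _ h) ?(Kt _ e) /cyc_between;
    by move: K2 Q1 lt pj jp b1 b2; clear; lia.
  have {}e : ~~ t (min_vertex P) by rewrite e.
  case: (cross _ _ q1Q jQ); rewrite ?(Kf _ h) ?(Kf _ e) /cyc_between;
  by move: K2 Q1 lt pj jp b1 b2; clear; lia.
move: tp; rewrite /left_of; case: (t j); case: (t (min_vertex P)) => //= _;
by move: lt pj q2j; clear; lia.
Qed.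

End Leftness.

Section Circle.

Local Open Scope ring_scope.

Variables (R : realFieldType) (n : nat) (pt : 'I_n.+1 -> R * R) (o : R * R) (r : R).
Variable t : nat -> bool.

Hypothesis pt_circle : forall i, ((pt i).1 - o.1) ^+ 2 + ((pt i).2 - o.2) ^+ 2 = r ^+ 2.
Hypothesis pt_height : forall i j : 'I_n.+1, (i < j)%N -> (pt j).2 < (pt i).2.
Hypothesis pt_side : forall i : 'I_n.+1, (0 < i < n)%N ->
  if t i then o.1 < (pt i).1 else (pt i).1 < o.1.

Implicit Types P Q : {set 'I_n.+1}.

Lemma hull_pt P i : i \in P -> in_hull pt P (pt i).
Proof.
have sumE (f : 'I_n.+1 -> R) : i \in P -> \sum_(j in P) (j == i)%:R * f j = f i.
  move=> iP; rewrite (bigD1 i) //= eqxx mul1r big1 ?addr0 // => j /andP [_ ji].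
  by rewrite (negPf ji) mul0r.
move=> iP; exists (fun j => (j == i)%:R); split=> [j _| | |]; first exact: ler0n.
- by rewrite -[RHS](sumE (fun=> 1) iP); apply: eq_bigr => j _; rewrite mulr1.
- by rewrite (sumE (fun j => (pt j).1)).
- by rewrite (sumE (fun j => (pt j).2)).
Qed.

Lemma hull_conv P z z' (l : R) : 0 <= l -> l <= 1 -> in_hull pt P z -> in_hull pt P z' ->
  in_hull pt P ((1 - l) * z.1 + l * z'.1, (1 - l) * z.2 + l * z'.2).
Proof.
move=> l0 l1 [a [a0 a1 ax ay]] [b [b0 b1 bx by_]].
exists (fun i => (1 - l) * a i + l * b i); split=> [i iP| | |] /=.
- by rewrite addr_ge0 // mulr_ge0 ?subr_ge0 ?a0 ?b0.
- by rewrite big_split /= -!mulr_sumr a1 b1; ring.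
- rewrite ax bx !mulr_sumr -big_split /=; apply: eq_bigr => i _; ring.
- rewrite ay by_ !mulr_sumr -big_split /=; apply: eq_bigr => i _; ring.
Qed.

(** The slack of a linear inequality at a point of the hull is the weighted mean of its slacks at
    the vertices. *)
Lemma hull_gap P z (u v M : R) : in_hull pt P z -> exists a : 'I_n.+1 -> R,
  [/\ forall i, i \in P -> 0 <= a i, \sum_(i in P) a i = 1 &
    M - (u * z.1 + v * z.2) = \sum_(i in P) a i * (M - (u * (pt i).1 + v * (pt i).2))].
Proof.
case=> a [a0 a1 -> ->]; exists a; split=> //.
rewrite -{1}[M]mulr1 -a1 !mulr_sumr -big_split /= -sumrB; apply: eq_bigr => i _; ring.
Qed.

Lemma hull_le P z (u v M : R) : (forall i, i \in P -> u * (pt i).1 + v * (pt i).2 <= M) ->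
  in_hull pt P z -> u * z.1 + v * z.2 <= M.
Proof.
move=> h /(hull_gap u v M) [a [a0 _ e]]; rewrite -subr_ge0 e; apply: sumr_ge0 => i iP.
by rewrite mulr_ge0 ?a0 // subr_ge0 h.
Qed.

Lemma hull_lt P z (u v M : R) : (forall i, i \in P -> u * (pt i).1 + v * (pt i).2 < M) ->
  in_hull pt P z -> u * z.1 + v * z.2 < M.
Proof.
move=> h hz; rewrite lt_neqAle (hull_le _ hz) ?andbT; last by move=> i /h /ltW.
have [a [a0 a1 e]] := hull_gap u v M hz; rewrite eq_sym -subr_eq0 e.
pose F i := a i * (M - (u * (pt i).1 + v * (pt i).2)).
have F0 i : i \in P -> 0 <= F i by move=> iP; rewrite mulr_ge0 ?a0 // subr_ge0 ltW // h.
apply/eqP => s0; have z0 i : i \in P -> F i = 0 by move: i; exact: psumr_eq0P F0 s0.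
have /eqP := a1; rewrite big1 ?[0 == 1]eq_sym ?oner_eq0 // => i iP.
have /eqP := z0 i iP; rewrite mulf_eq0 subr_eq0 => /orP [/eqP //|].
by rewrite gt_eqF // h.
Qed.

Lemma pt_height_le (i j : 'I_n.+1) : ((pt j).2 <= (pt i).2) = (i <= j)%N.
Proof.
case: (ltngtP i j) => [/pt_height /ltW -> //|/pt_height|/val_inj ->]; last by rewrite lexx.
by move=> h; apply/negbTE; rewrite -ltNge.
Qed.

Lemma hull_height P z i : i \in P -> in_hull pt P z ->
  (pt (max_vertex P)).2 <= z.2 /\ z.2 <= (pt (min_vertex P)).2.
Proof.
move=> iP hz; split.
  have := hull_le (u := 0) (v := -1) (M := - (pt (max_vertex P)).2) _ hz.
  rewrite !mul0r !add0r !mulN1r lerN2; apply=> j jP.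
  by rewrite mul0r add0r mulN1r lerN2 pt_height_le; case: (max_vertexP jP).
have := hull_le (u := 0) (v := 1) (M := (pt (min_vertex P)).2) _ hz.
rewrite !mul0r !add0r !mul1r; apply=> j jP.
by rewrite mul0r add0r mul1r pt_height_le; case: (min_vertexP jP).
Qed.

(* The tangent at [pt j] separates [pt j] from the hull of the other points. *)
Lemma hull_side P z j : j \notin P -> in_hull pt P z -> z.2 = (pt j).2 -> (0 < j < n)%N ->
  if t j then z.1 < (pt j).1 else (pt j).1 < z.1.
Proof.
move=> jP hz ez jn; have := pt_side jn.
set u := (pt j).1 - o.1; set v := (pt j).2 - o.2.
have tangent i : i \in P -> u * (pt i).1 + v * (pt i).2 < u * (pt j).1 + v * (pt j).2.
  move=> iP; have ij : i != j by apply: contraNneq jP => <-.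
  have d : (pt i).2 != (pt j).2.
    case: (ltngtP i j) => [/pt_height/gt_eqF -> //|/pt_height/lt_eqF -> //|/val_inj e].
    by rewrite e eqxx in ij.
  (* Both points being on the circle, the two sides of the tangent inequality differ by half the
     squared distance between the points. *)
  have d2 : 0 < ((pt i).2 - (pt j).2) ^+ 2 by rewrite exprn_even_gt0 //= subr_eq0.
  have d1 : 0 <= ((pt i).1 - (pt j).1) ^+ 2 by exact: sqr_ge0.
  have := pt_circle i; have := pt_circle j; rewrite /u /v; nra.
have := hull_lt tangent hz; rewrite ez ltrD2r -subr_gt0 -mulrBr /u => h'.
by case: (t j) => h; move: h'; [rewrite pmulr_rgt0 ?subr_gt0 | rewrite nmulr_rgt0 ?subr_lt0].
Qed.

(** Heights of vertices are distinct, so at an extreme height all the weight is on [j]. *)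
Lemma hull_extreme P z j : (j == min_vertex P) || (j == max_vertex P) -> j \in P ->
  in_hull pt P z ->
  z.2 = (pt j).2 -> z.1 = (pt j).1.
Proof.
move=> jx jP [a [a0 a1 -> ->]] e.
have tot : \sum_(i in P) a i * ((pt j).2 - (pt i).2) = 0.
  under eq_bigr do rewrite mulrBr.
  by rewrite sumrB e -mulr_suml a1 mul1r subrr.
have az i : i \in P -> i != j -> a i = 0.
  move=> iP ij.
  have ne : (pt j).2 - (pt i).2 != 0.
    rewrite subr_eq0; case: (ltngtP i j) => [/pt_height/lt_eqF -> //|/pt_height/gt_eqF ->
      //|/val_inj e'].
    by rewrite e' eqxx in ij.
  suff : a i * ((pt j).2 - (pt i).2) = 0.
    by move/eqP; rewrite mulf_eq0 (negPf ne) orbF => /eqP.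
  case/orP: jx => /eqP jE.
    apply: (psumr_eq0P _ tot) => // k kP; rewrite mulr_ge0 ?a0 // subr_ge0 pt_height_le.
    by rewrite jE; case: (min_vertexP kP).
  apply: oppr_inj; rewrite oppr0; move: i iP {ij ne}; apply: psumr_eq0P.
    move=> k kP; rewrite -mulrN mulr_ge0 ?a0 // oppr_ge0 subr_le0 pt_height_le.
    by rewrite jE; case: (max_vertexP kP).
  by rewrite sumrN tot oppr0.
have aj : a j = 1.
  by rewrite -a1 (bigD1 j) //= big1 ?addr0 // => i /andP [iP ij]; exact: az.
rewrite (bigD1 j) //= aj mul1r big1 ?addr0 // => i /andP [iP ij].
by rewrite az // mul0r.
Qed.

Lemma hull_at P i h : i \in P -> (pt (max_vertex P)).2 <= h -> h <= (pt (min_vertex P)).2 ->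
  exists2 z, in_hull pt P z & z.2 = h.
Proof.
move=> iP; have [h1 _] := min_vertexP iP; have [h2 _] := max_vertexP iP.
set y1 := (pt (min_vertex P)).2; set y2 := (pt (max_vertex P)).2 => l1 l2.
have [e|ne] := eqVneq y1 y2.
  by exists (pt (min_vertex P)); [exact: hull_pt|rewrite -/y1; apply/le_anti;
    rewrite -{1}e in l1; rewrite l1 l2].
have d : 0 < y1 - y2 by rewrite subr_gt0 lt_neqAle eq_sym ne (le_trans l1).
pose l := (y1 - h) / (y1 - y2).
have l0 : 0 <= l by apply: divr_ge0; [rewrite subr_ge0|exact: ltW].
have l1' : l <= 1 by rewrite ler_pdivrMr // mul1r lerD2l lerN2.
exists ((1 - l) * (pt (min_vertex P)).1 + l * (pt (max_vertex P)).1, (1 - l) * y1 + l * y2).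
  by apply: hull_conv => //; exact: hull_pt.
have e : l * (y1 - y2) = y1 - h by rewrite /l divfK // gt_eqF.
rewrite /=; have -> : (1 - l) * y1 + l * y2 = y1 - l * (y1 - y2) by ring.
by rewrite e; ring.
Qed.

Lemma straddle_height P (j : 'I_n.+1) : min_vertex P \in P -> (min_vertex P < j < max_vertex P)%N ->
  exists2 z, in_hull pt P z & z.2 = (pt j).2.
Proof.
by move=> mP /andP [l1 l2]; apply: (hull_at mP); rewrite pt_height_le ltnW.
Qed.

Lemma straddle_interior P (j : 'I_n.+1) : (min_vertex P < j < max_vertex P)%N -> (0 < j < n)%N.
Proof. by have := ltn_ord (max_vertex P); lia. Qed.

Lemma left_of_strictly_left P Q : min_vertex P \in P -> min_vertex Q \in Q -> [disjoint P & Q] ->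
  left_of t P Q -> strictly_left pt P Q.
Proof.
move=> mP mQ dis /orP [/andP [st tQ]|/andP [st tP]].
  have [z hz ez] := straddle_height mP st.
  exists (pt (min_vertex Q)).2; split; [by exists z|by exists (pt (min_vertex Q)); split;
    first exact: hull_pt|].
  move=> z1 z2 h1 e1 h2 e2; rewrite (hull_extreme _ mQ h2 e2) ?eqxx //.
  have := hull_side _ h1 e1 (straddle_interior st); rewrite tQ; apply.
  by rewrite (disjointFl dis mQ).
have [z hz ez] := straddle_height mQ st.
exists (pt (min_vertex P)).2; split; [by exists (pt (min_vertex P)); split;
  first exact: hull_pt|by exists z|].
move=> z1 z2 h1 e1 h2 e2; rewrite (hull_extreme _ mP h1 e1) ?eqxx //.
have := hull_side _ h2 e2 (straddle_interior st); rewrite (negPf tP); apply.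
by rewrite (disjointFr dis mP).
Qed.

(* The two hulls are compared at the ends of their common range of heights; in
   between, by interpolation. *)
Lemma left_of_not_strictly_right P Q : min_vertex P \in P -> min_vertex Q \in Q ->
  [disjoint P & Q] ->
  uncrossed t P Q -> uncrossed t Q P -> left_of t P Q -> ~ strictly_left pt Q P.
Proof.
move=> mP mQ dis ncPQ ncQP PQ [h [[q0 [hq0 eq0]] [p0 [hp0 ep0]] sl]].
have disQP : [disjoint Q & P] by rewrite disjoint_sym.
have [xP _] := max_vertexP mP; have [xQ _] := max_vertexP mQ.
have sidePQ (j : 'I_n.+1) : j \in Q -> (min_vertex P < j < max_vertex P)%N -> t j ->
    exists p q, [/\ in_hull pt P p, in_hull pt Q q, p.2 = (pt j).2, q.2 = (pt j).2 & p.1 < q.1].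
  move=> jQ st tj; have [z hz ez] := straddle_height mP st.
  exists z, (pt j); split=> //; first exact: hull_pt.
  have := hull_side _ hz ez (straddle_interior st); rewrite tj; apply.
  by rewrite (disjointFl dis jQ).
have sideQP (j : 'I_n.+1) : j \in P -> (min_vertex Q < j < max_vertex Q)%N -> ~~ t j ->
    exists p q, [/\ in_hull pt P p, in_hull pt Q q, p.2 = (pt j).2, q.2 = (pt j).2 & p.1 < q.1].
  move=> jP st tj; have [z hz ez] := straddle_height mQ st.
  exists (pt j), z; split=> //; first exact: hull_pt.
  have := hull_side _ hz ez (straddle_interior st); rewrite (negPf tj); apply.
  by rewrite (disjointFr dis jP).
have neq (a b : 'I_n.+1) : a \in P -> b \in Q -> nat_of_ord a <> b.
  by move=> aP bQ /val_inj e; move: bQ; rewrite -e (disjointFr dis aP).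
have [u [pu [qu [hpu hqu epu equ lu]]] uhi] : exists2 u : 'I_n.+1,
    exists p q, [/\ in_hull pt P p, in_hull pt Q q, p.2 = (pt u).2, q.2 = (pt u).2 & p.1 < q.1]
    & h <= (pt u).2.
  case/orP: PQ => /andP [st tt].
    by exists (min_vertex Q); [exact: sidePQ|rewrite -eq0; case: (hull_height mQ hq0)].
  by exists (min_vertex P); [exact: sideQP|rewrite -ep0; case: (hull_height mP hp0)].
have overlap : (min_vertex P < max_vertex Q)%N && (min_vertex Q < max_vertex P)%N.
  have := max_vertexP mP; have := max_vertexP mQ; case/orP: PQ => /andP [st _] [_ h1] [_ h2]; lia.
(* [left_of] speaks of highest vertices only; at the lower end of the common range, [straddle] gives
   the side of the vertex, the reverse relation being excluded by asymmetry. *)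
have [v [pv [qv [hpv hqv epv eqv lv]]] vlo] : exists2 v : 'I_n.+1,
    exists p q, [/\ in_hull pt P p, in_hull pt Q q, p.2 = (pt v).2, q.2 = (pt v).2 & p.1 < q.1]
    & (pt v).2 <= h.
  case/andP: overlap => o1 o2.
  have [lt|le] := ltnP (max_vertex Q) (max_vertex P).
    have st : (min_vertex P < max_vertex Q < max_vertex P)%N by rewrite o1.
    exists (max_vertex Q); last by rewrite -eq0; case: (hull_height mQ hq0).
    apply: sidePQ => //; have := straddle ncPQ dis mP xQ st.
    by case: (t _) => // /left_of_asym; rewrite PQ.
  have st : (min_vertex Q < max_vertex P < max_vertex Q)%N by have := neq _ _ xP xQ;
    rewrite o2 /=; lia.
  exists (max_vertex P); last by rewrite -ep0; case: (hull_height mP hp0).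
  apply: sideQP => //; have := straddle ncQP disQP mQ xP st.
  by case: (t _) => // /left_of_asym; rewrite PQ.
have [e|ne] := eqVneq (pt u).2 (pt v).2.
  have eh : (pt u).2 = h by apply/le_anti; rewrite uhi {1}e vlo.
  by have := sl _ _ hqu (etrans equ eh) hpu (etrans epu eh); rewrite ltNge ltW.
set y1 := (pt u).2 in epu equ uhi ne; set y2 := (pt v).2 in epv eqv vlo ne.
have d : 0 < y1 - y2 by rewrite subr_gt0 lt_neqAle eq_sym ne (le_trans vlo).
pose l := (y1 - h) / (y1 - y2).
have l0 : 0 <= l by apply: divr_ge0; [rewrite subr_ge0|exact: ltW].
have l1 : l <= 1 by rewrite ler_pdivrMr // mul1r lerD2l lerN2.
have le : l * (y1 - y2) = y1 - h by rewrite /l divfK // gt_eqF.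
have hE : (1 - l) * y1 + l * y2 = h.
  have -> : (1 - l) * y1 + l * y2 = y1 - l * (y1 - y2) by ring.
  by rewrite le; ring.
have := sl _ _ (hull_conv l0 l1 hqu hqv) _ (hull_conv l0 l1 hpu hpv).
rewrite /= equ eqv epu epv hE => /(_ erefl erefl); apply/negP; rewrite -leNgt.
by apply: lerD; apply: ler_wpM2l; rewrite ?subr_ge0 // ltW.
Qed.

Lemma strictly_leftP P Q : min_vertex P \in P -> min_vertex Q \in Q -> [disjoint P & Q] ->
  uncrossed t P Q -> uncrossed t Q P -> strictly_left pt P Q <-> left_of t P Q.
Proof.
move=> mP mQ dis ncPQ ncQP; split; last exact: left_of_strictly_left.
move=> sl; have disQP : [disjoint Q & P] by rewrite disjoint_sym.
have nQP : ~~ left_of t Q P.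
  by apply/negP => QP; exact: (left_of_not_strictly_right mQ mP disQP ncQP ncPQ QP sl).
case: sl => h [[p0 [hp0 ep0]] [q0 [hq0 eq0]] _].
have neq (a b : 'I_n.+1) : a \in P -> b \in Q -> nat_of_ord a <> b.
  by move=> aP bQ /val_inj e; move: bQ; rewrite -e (disjointFr dis aP).
have [xP _] := max_vertexP mP; have [xQ _] := max_vertexP mQ.
have [p1 p2] := hull_height mP hp0; have [q1 q2] := hull_height mQ hq0.
rewrite ep0 in p1 p2; rewrite eq0 in q1 q2.
have o1 : (min_vertex P <= max_vertex Q)%N by rewrite -pt_height_le (le_trans q1).
have o2 : (min_vertex Q <= max_vertex P)%N by rewrite -pt_height_le (le_trans p1).
have := neq _ _ mP mQ; have := neq _ _ mP xQ; have := neq _ _ xP mQ.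
move: nQP o1 o2; rewrite /left_of; case: (t (min_vertex P)); case: (t (min_vertex Q)) => /=;
  clear; lia.
Qed.

End Circle.

(** * The order on the polygons *)

Section PolygonOrder.

Variables (R : realFieldType) (n : nat) (pt : 'I_n.+1 -> R * R) (t : nat -> bool) (x : 'S_n.+1).
Implicit Types P Q : {set 'I_n.+1}.

Hypothesis uncrossed_porbits : forall P Q, P \in porbits x -> Q \in porbits x -> P != Q ->
  uncrossed t P Q.
Hypothesis strictly_left_porbits : forall P Q, P \in porbits x -> Q \in porbits x -> P != Q ->
  strictly_left pt P Q <-> left_of t P Q.

Lemma mem_porbits_eq P i : P \in porbits x -> i \in P -> P = porbit x i.
Proof. by case/imsetP=> j _ -> /[dup] ij; rewrite -eq_porbit_mem => /eqP. Qed.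

Lemma porbits_disjoint P Q : P \in porbits x -> Q \in porbits x -> P != Q -> [disjoint P & Q].
Proof.
move=> hP hQ ne; apply/pred0P => i /=; apply/negP => /andP [iP iQ]; case/negP: ne.
by rewrite (mem_porbits_eq hP iP) (mem_porbits_eq hQ iQ).
Qed.

Lemma porbits_extremes P : P \in porbits x -> min_vertex P \in P /\ max_vertex P \in P.
Proof.
case/imsetP=> j _ ->; have jj := porbit_id x j.
by split; [case: (min_vertexP jj)|case: (max_vertexP jj)].
Qed.

Lemma right_freeP (D : {set {set 'I_n.+1}}) P : D \subset porbits x -> P \in D ->
  reflect (forall Q, Q \in D -> Q != P -> ~~ left_of t P Q) (right_free pt D P).
Proof.
move=> /subsetP sD PD; apply: (iffP forallP) => h Q.
  move=> QD QP; have := h Q; rewrite QD QP /= => /asboolP nl; apply/negP => l; apply: nl.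
  by apply/strictly_left_porbits => //; rewrite 1?eq_sym ?sD.
apply/implyP => QD; apply/implyP => QP; apply/asboolP => /strictly_left_porbits.
by rewrite !sD // eq_sym QP => /(_ isT isT isT); apply/negP; exact: h.
Qed.

(* Among the polygons that start at the top or on the right side of the
   circle, the one starting lowest has nothing at its right. *)
Lemma right_free_exists (D : {set {set 'I_n.+1}}) : D \subset porbits x -> D != set0 ->
  exists2 P, P \in D & right_free pt D P.
Proof.
move=> sD /set0Pn [P0 P0D].
have [Pm PmD minPm] := @arg_minnP _ P0 (mem D) (fun P => min_vertex P) P0D.
have {}PmD : Pm \in D := PmD.
pose A := [pred P | (P \in D) && ((P == Pm) || t (min_vertex P))].
have [|P /andP [PD AP] maxP] := @arg_maxnP _ Pm A (fun P => min_vertex P).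
  by rewrite /A /= PmD eqxx.
exists P => //; apply/right_freeP => // Q QD QP; apply/negP => /orP [|] /andP [st tt].
  by have := maxP Q; rewrite /A /= QD tt orbT => /(_ isT); move: st; clear; lia.
case/orP: AP => [/eqP e|tP]; last by rewrite tP in tt.
by have := minPm Q QD; rewrite /= -e; move: st; clear; lia.
Qed.

Lemma is_first_exists (D : {set {set 'I_n.+1}}) : D \subset porbits x -> D != set0 ->
  exists P, is_first pt D P.
Proof.
move=> sD D0; have [P PD rP] := right_free_exists sD D0.
have [|Q /andP [QD rQ] minQ] := @arg_minnP _ P (fun P => (P \in D) &&
  right_free pt D P) (@max_label n).
  by rewrite PD.
exists Q; rewrite /is_first QD rQ /=; apply/forallP => S; apply/implyP => SD.
by apply/implyP => rS; apply: minQ; rewrite SD.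
Qed.

(** Otherwise [Q] lies entirely above [P]. By the choice of [P], something in [D] is then at the
    right of [Q], and it can only be [P]; but the height ranges do not overlap. The inequality makes
    the junction of consecutive polygons an ascent. *)
Lemma is_first_next (D : {set {set 'I_n.+1}}) P Q : D \subset porbits x -> is_first pt D P ->
  is_first pt (D :\ P) Q -> min_vertex P < max_vertex Q.
Proof.
move=> sD /and3P [PD _ /forallP minP] /and3P [QD' rQ _].
move: (QD'); rewrite !inE => /andP [QP QD].
have sD' : D :\ P \subset porbits x by apply: subset_trans sD; exact: subsetDl.
have pP := subsetP sD _ PD; have pQ := subsetP sD _ QD.
have [mP xP] := porbits_extremes pP; have [mQ xQ] := porbits_extremes pQ.
have dis : [disjoint P & Q] by apply: porbits_disjoint; rewrite // eq_sym.
have ne : nat_of_ord (max_vertex P) <> max_vertex Q.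
  by move/val_inj => e; move: xQ; rewrite -e (disjointFr dis xP).
have [_ le] := min_vertexP xP.
have [lt|le'] := ltnP (max_vertex Q) (max_vertex P); last by move: le le' ne; clear; lia.
apply: contraT => np; have : ~~ right_free pt D Q.
  apply/negP => rQ'; have := minP Q; rewrite QD rQ' /= (max_labelE xP) (max_labelE xQ).
  by move: lt; clear; lia.
case/(right_freeP sD QD) => S SD SQ; apply/negP => l.
have SP : S = P.
  apply/eqP; apply: contraT => SP; have /(right_freeP sD' QD') := rQ.
  by move/(_ S); rewrite !inE SP SD SQ l => /(_ isT isT).
by move: l; rewrite SP /left_of; have [_] := max_vertexP mQ; move: lt np; clear; lia.
Qed.

(** The last clause serves the induction, where [is_first_next] needs to know how the next head was
    chosen. *)
Lemma prec_enum_recP k (D : {set {set 'I_n.+1}}) : D \subset porbits x -> #|D| = k ->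
  let s := prec_enum_rec pt k D in
  [/\ s =i D, pairwise (fun P Q => ~~ left_of t P Q && (P != Q)) s,
      sorted (fun P Q => min_vertex P < max_vertex Q) s & forall P s', s = P :: s' ->
        is_first pt D P].
Proof.
elim: k D => [|k IH] D sD cD /=.
  by split=> // P; rewrite (cards0_eq cD) inE in_nil.
have D0 : D != set0 by rewrite -card_gt0 cD.
have [P0 fP0] := is_first_exists sD D0.
case: pickP => [P fP|/(_ P0)]; last by rewrite fP0.
have PD : P \in D by case/and3P: fP.
have sD' : D :\ P \subset porbits x by apply: subset_trans sD; exact: subsetDl.
have cD' : #|D :\ P| = k by move: cD; rewrite (cardsD1 P) PD add1n => -[].
have [hm hp hs hf] := IH _ sD' cD'; set s := prec_enum_rec pt k (D :\ P) in hm hp hs hf *.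
split=> [Q| | |Q s' [<- _] //].
- by rewrite inE hm !inE; case: eqP => [->|].
- rewrite pairwise_cons hp andbT; apply/allP => Q; rewrite hm !inE => /andP [QP QD].
  rewrite eq_sym QP andbT; case/and3P: fP => _ /(right_freeP sD PD) rP _.
  exact: rP.
- case: s hm hp hs hf => //= Q s' hm hp hs hf; rewrite hs andbT.
  exact: is_first_next fP (hf _ _ erefl).
Qed.

Definition polys := prec_enum pt (Pol x).

Lemma polysP : [/\ polys =i porbits x, uniq polys,
  forall i j, i < j < size polys -> ~~ left_of t (nth set0 polys i) (nth set0 polys j) &
  forall i, i.+1 < size polys -> min_vertex (nth set0 polys i) < max_vertex (nth set0 polys i.+1)].
Proof.
have [hm hp hs _] := prec_enum_recP (subxx (porbits x)) erefl.
rewrite /polys /prec_enum /Pol; set s := prec_enum_rec _ _ _ in hm hp hs *; split=> //.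
- by rewrite uniq_pairwise; apply: sub_pairwise hp => P Q /andP [].
- move=> i j /andP [ij js]; have /(pairwiseP set0) h := hp.
  by have := h i j; rewrite !inE => /(_ (ltn_trans ij js) js ij) /andP [].
- by move=> i si; have /(sortedP set0) := hs; apply.
Qed.

Definition block_rank (a : 'I_n.+1) : nat := index (porbit x a) polys.

Lemma porbit_polys a : porbit x a \in polys.
Proof. by have [-> _ _ _] := polysP; apply/imsetP; exists a. Qed.

Lemma block_rank_lt a : block_rank a < size polys.
Proof. by rewrite index_mem porbit_polys. Qed.

Lemma nth_block_rank a : nth set0 polys (block_rank a) = porbit x a.
Proof. by rewrite nth_index ?porbit_polys. Qed.

Lemma block_rank_eq a b : (block_rank a == block_rank b) = (a \in porbit x b).
Proof.
rewrite -eq_porbit_mem; apply/eqP/eqP => [e|e]; last by rewrite /block_rank e.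
by rewrite -nth_block_rank e nth_block_rank.
Qed.

Lemma block_rank_nth r a : r < size polys -> a \in nth set0 polys r -> block_rank a = r.
Proof.
move=> rs ar; have [hm hu _ _] := polysP.
have pr : nth set0 polys r \in porbits x by rewrite -hm mem_nth.
by rewrite /block_rank -(mem_porbits_eq pr ar) index_uniq.
Qed.

Definition line_lt (a b : 'I_n.+1) : bool := (block_rank a < block_rank b) ||
  (block_rank a == block_rank b) && (b < a).

Lemma line_pairwise : pairwise line_lt (line_notation pt x).
Proof.
rewrite /line_notation -/polys; have [_ hu _ _] := polysP.
have hr : {in polys, forall P a, a \in P -> block_rank a = index P polys}.
  move=> P hP a aP; have := block_rank_nth (r := index P polys) (a := a).
  by rewrite nth_index // index_mem => ->.
have hp : pairwise (fun P Q => index P polys < index Q polys) polys.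
  apply/(pairwiseP set0) => i j; rewrite !inE => si sj ij.
  by rewrite !index_uniq.
have dec P : decreasing_enum P =i P by move=> a; rewrite mem_sort mem_enum.
have decp P : pairwise (fun a b : 'I_n.+1 => b < a) (decreasing_enum P).
  have u : uniq (decreasing_enum P) by rewrite sort_uniq enum_uniq.
  have : sorted (fun a b : 'I_n.+1 => b <= a) (decreasing_enum P).
    by apply: sort_sorted => a b; exact: leq_total.
  rewrite sorted_pairwise; last by move=> a b c h1 h2; exact: leq_trans h2 h1.
  move: u; rewrite uniq_pairwise => u h; move: (conj u h) => /andP; rewrite -pairwise_relI.
  apply: sub_pairwise => a b /= /andP [ne le]; rewrite ltn_neqAle le andbT.
  by rewrite eq_sym.
have main (s : seq {set 'I_n.+1}) : {subset s <= polys} ->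
    pairwise (fun P Q => index P polys < index Q polys) s ->
    pairwise line_lt (flatten [seq decreasing_enum P | P <- s]).
  elim: s => [|P s IH] //= sub /andP [/allP hP hs].
  have Pp : P \in polys by apply: sub; rewrite inE eqxx.
  have {}sub : {subset s <= polys} by move=> Q Qs; apply: sub; rewrite inE Qs orbT.
  rewrite pairwise_cat IH // andbT; apply/andP; split.
    apply/allrelP => a b; rewrite dec => aP /flattenP [_ /mapP [Q Qs ->]].
    by rewrite dec => bQ; rewrite /line_lt (hr _ Pp _ aP) (hr _ (sub _ Qs) _ bQ) hP.
  rewrite -(eq_in_pairwise (P := mem P) (r := fun a b : 'I_n.+1 => b < a)).
  - exact: decp.
  - by move=> a b aP bP /=; rewrite /line_lt (hr _ Pp _ aP) (hr _ Pp _ bP) ltnn eqxx.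
  - by apply/allP => a; rewrite dec.
exact: main.
Qed.

Lemma mem_line a : a \in line_notation pt x.
Proof.
apply/flattenP; exists (decreasing_enum (porbit x a)).
  by apply/mapP; exists (porbit x a) => //; exact: porbit_polys.
by rewrite mem_sort mem_enum porbit_id.
Qed.

Lemma line_uniq : uniq (line_notation pt x).
Proof. by apply: pairwise_uniq line_pairwise => a; rewrite /line_lt !ltnn andbF. Qed.

Lemma size_line : size (line_notation pt x) = n.+1.
Proof.
rewrite -(card_uniqP line_uniq) -[RHS]card_ord; apply: eq_card => a.
by rewrite mem_line.
Qed.

Local Notation w := (Sc pt x).

Lemma ScE (p : 'I_n.+1) : w p = nth ord0 (line_notation pt x) p.
Proof.
rewrite -pvalE /Sc insubdK ?ffunE //.
rewrite unfold_in; apply/injectiveP => p' q'; rewrite !ffunE => /eqP.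
by rewrite nth_uniq ?size_line ?line_uniq // => /eqP /val_inj.
Qed.

Lemma pos_Sc (a : 'I_n.+1) : pos w a = index a (line_notation pt x).
Proof.
have lt : index a (line_notation pt x) < n.+1.
  by apply: leq_trans (_ : size (line_notation pt x) <= _); rewrite ?index_mem ?mem_line ?size_line.
have e : w (Ordinal lt) = a by rewrite ScE nth_index ?mem_line.
by rewrite -{1}e pos_perm.
Qed.

Lemma pos_Sc_lt (a b : 'I_n.+1) : (pos w a < pos w b) = line_lt a b.
Proof.
have imp (c d : 'I_n.+1) : pos w c < pos w d -> line_lt c d.
  rewrite !pos_Sc => lt; have /(pairwiseP ord0) h := line_pairwise.
  have := h (index c (line_notation pt x)) (index d (line_notation pt x)).
  by rewrite !inE !index_mem !mem_line !nth_index ?mem_line //; apply.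
apply/idP/idP; first exact: imp.
move=> ab; rewrite ltnNge leq_eqVlt; apply/negP => /orP [/eqP e|/imp ba].
  have := pos_inj (leq_ord b) (leq_ord a) e; move: ab; rewrite /line_lt => ab /val_inj e'.
  by move: ab; rewrite e' ltnn eqxx ltnn.
by move: ab ba; rewrite /line_lt; lia.
Qed.

(** A discrete intermediate value argument: if a polygon lies entirely below the height of [j], the
    next one still reaches below that height, so the passage to a polygon reaching above it goes
    through one that straddles it. *)
Lemma polys_chain (j : 'I_n.+1) r s : r <= s -> s < size polys ->
  (forall k, r <= k <= s -> j \notin nth set0 polys k) ->
  j < max_vertex (nth set0 polys r) -> min_vertex (nth set0 polys s) < j ->
  exists2 k, r <= k <= s & min_vertex (nth set0 polys k) < j < max_vertex (nth set0 polys k).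
Proof.
move=> rs ss; have [hm _ _ hc] := polysP.
have [d] := ubnP (s - r); elim: d r rs => // d IH r rs hd nj jr js.
have rp : nth set0 polys r \in porbits x by rewrite -hm mem_nth // (leq_ltn_trans rs).
have [mr _] := porbits_extremes rp.
have [lt|le] := ltnP (min_vertex (nth set0 polys r)) j.
  by exists r; rewrite ?leqnn ?rs // lt jr.
have ne : nat_of_ord j <> min_vertex (nth set0 polys r).
  by move/val_inj => e; have := nj r; rewrite leqnn rs e mr => /(_ isT).
have rs' : r < s by rewrite ltn_neqAle rs andbT; apply/eqP => e; rewrite e in le; lia.
have h := hc r (leq_ltn_trans rs' ss).
have nj' k : r < k <= s -> j \notin nth set0 polys k.
  by move=> /andP [k1 k2]; apply: nj; rewrite k2 ltnW.
have hd1 : s - r.+1 < d by move: hd rs'; clear; lia.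
have jr1 : j < max_vertex (nth set0 polys r.+1) by move: h le ne; clear; lia.
have [k hk hj] := IH r.+1 rs' hd1 nj' jr1 js.
by exists k => //; move: hk; clear; lia.
Qed.

Lemma Sc_consecutive (a b : 'I_n.+1) : pos w b = (pos w a).+1 ->
  block_rank a < block_rank b -> a < b.
Proof.
move=> e lt; have [hm _ _ hc] := polysP.
have betw (z : 'I_n.+1) : pos w a < pos w z -> pos w z < pos w b -> False.
  by rewrite e; lia.
have pa : porbit x a \in porbits x by apply/imsetP; exists a.
have pb : porbit x b \in porbits x by apply/imsetP; exists b.
have [ma _] := porbits_extremes pa; have [_ xb] := porbits_extremes pb.
have ra : block_rank (min_vertex (porbit x a)) = block_rank a by apply/eqP; rewrite block_rank_eq.
have rb : block_rank (max_vertex (porbit x b)) = block_rank b by apply/eqP; rewrite block_rank_eq.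
have ea : a <= min_vertex (porbit x a).
  rewrite leqNgt; apply/negP => h; apply: (betw (min_vertex (porbit x a)));
    rewrite pos_Sc_lt /line_lt ra.
    by rewrite eqxx h orbT.
  by rewrite lt.
have eb : max_vertex (porbit x b) <= b.
  rewrite leqNgt; apply/negP => h; apply: (betw (max_vertex (porbit x b)));
    rewrite pos_Sc_lt /line_lt rb.
    by rewrite lt.
  by rewrite eqxx h orbT.
have rs := block_rank_lt b.
have eR : block_rank b = (block_rank a).+1.
  apply/eqP; rewrite eqn_leq lt andbT leqNgt; apply/negP => h.
  have rs' : (block_rank a).+1 < size polys by exact: ltn_trans h rs.
  have pc : nth set0 polys (block_rank a).+1 \in porbits x by rewrite -hm mem_nth.
  have [mc _] := porbits_extremes pc; have rc := block_rank_nth rs' mc.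
  by apply: (betw (min_vertex (nth set0 polys (block_rank a).+1)));
    rewrite pos_Sc_lt /line_lt rc ?h ?ltnSn.
have := hc (block_rank a); rewrite -eR !nth_block_rank => /(_ rs) h.
by apply: leq_ltn_trans ea _; exact: leq_trans h eb.
Qed.

Let pos_w p : p <= n -> pos w (w (inord p)) = p.
Proof. by move=> pn; rewrite pos_perm inordK. Qed.

Lemma Sc_descent p : p < n ->
  (p \in descents w) = (block_rank (w (inord p)) == block_rank (w (inord p.+1))).
Proof.
move=> pn; rewrite mem_descents pn /= /nat_app.
have e : pos w (w (inord p.+1)) = (pos w (w (inord p))).+1 by rewrite !pos_w //; lia.
have := pos_Sc_lt (w (inord p)) (w (inord p.+1)); rewrite e ltnSn /line_lt => /esym.
case/orP=> [lt|/andP [re lt]]; last by rewrite re lt.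
have lt' := Sc_consecutive e lt.
rewrite [RHS]ltn_eqF //; apply/negbTE; rewrite -leqNgt; exact: ltnW.
Qed.

Lemma same_run_Sc i j : same_run w i j <-> j \in porbit x i.
Proof.
rewrite porbit_sym -block_rank_eq.
have posK (a : 'I_n.+1) : w (inord (pos w a)) = a.
  by rewrite pos_ord inord_val permKV.
suff main (a b : 'I_n.+1) : pos w a <= pos w b -> same_run w a b <-> block_rank a == block_rank b.
  case/orP: (leq_total (pos w i) (pos w j)) => /main //.
  by rewrite eq_sym => h; split=> [/linked_sym/h //|/h /linked_sym].
have mono (c d : 'I_n.+1) : pos w c <= pos w d -> block_rank c <= block_rank d.
  rewrite leq_eqVlt => /orP [/eqP /(pos_inj (leq_ord c) (leq_ord d)) /val_inj -> //|].
  by rewrite pos_Sc_lt /line_lt; lia.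
move=> le; split=> [h|/eqP e k hk]; last first.
  have kn : k < n by have := pos_le w b; lia.
  have k1 : pos w (w (inord k)) = k by rewrite pos_w //; lia.
  have k2 : pos w (w (inord k.+1)) = k.+1 by rewrite pos_w.
  rewrite Sc_descent // eqn_leq; apply/andP; split; first by apply: mono; rewrite k1 k2.
  apply: (@leq_trans (block_rank a)); last by apply: mono; rewrite k1; lia.
  by rewrite e; apply: mono; rewrite k2; lia.
suff step q : pos w a <= q -> q <= pos w b -> block_rank a == block_rank (w (inord q)).
  by have := step _ le (leqnn _); rewrite posK.
elim: q => [|q IH] aq qb; first by rewrite -{1}(posK a); move: aq; rewrite leqn0 => /eqP ->.
have [e|ne] := eqVneq (pos w a) q.+1; first by rewrite -e posK.
have aq' : pos w a <= q by move: aq ne; clear; lia.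
rewrite (eqP (IH aq' (ltnW qb))) -Sc_descent; last exact: leq_trans qb (pos_le w b).
by apply: h; left; rewrite aq' qb.
Qed.

(** If [j] violated alignment, its polygon would come after that of [i] or before that of [k]. Some
    polygon from that of [k] to that of [i] straddles the height of [j], and [straddle] makes an
    earlier polygon lie at the left of a later one, which the order excludes. *)
Lemma Sc_aligned (u : seq nat) : (forall m, m < n -> m \in u) -> (forall j,
  tau u j = t j) -> aligned u w.
Proof.
move=> hu tu; split=> [i k ik kn _ m im mk|]; first by apply: hu; lia.
have [hm _ hl hc] := polysP.
suff main (i j k : 'I_n.+1) : i < j -> j < k -> pos w k < pos w i ->
    if tau u j then pos w j < pos w i else pos w k < pos w j.
  move=> i j k ij jk kn; have := main (inord i) (inord j) (inord k).
  by rewrite !inordK //; [apply|lia..].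
move=> ij jk ki; rewrite tu.
have npos (a b : 'I_n.+1) : ~~ (pos w a < pos w b) -> a <> b -> line_lt b a.
  move=> h ne; rewrite -pos_Sc_lt ltn_neqAle leqNgt h andbT; apply: contra_notN ne.
  by move/eqP/(pos_inj (leq_ord b) (leq_ord a))/val_inj.
have rki : block_rank k <= block_rank i by move: ki; rewrite pos_Sc_lt /line_lt; lia.
have nth_in (a : 'I_n.+1) : a \in nth set0 polys (block_rank a) by rewrite nth_block_rank porbit_id.
have chain : (forall z, block_rank k <= z <= block_rank i -> z != block_rank j) ->
    exists2 z, block_rank k <= z <= block_rank i & min_vertex (nth set0 polys z) < j <
      max_vertex (nth set0 polys z).
  move=> h; apply: polys_chain => //; first exact: block_rank_lt.
  - move=> z hz; apply/negP => /block_rank_nth e; case/negP: (h z hz); rewrite e //.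
    by apply: leq_ltn_trans (block_rank_lt i); case/andP: hz.
  - by apply: leq_trans jk _; case: (max_vertexP (nth_in k)).
  - by apply: leq_ltn_trans ij; case: (min_vertexP (nth_in i)).
have strad z : block_rank k <= z <= block_rank i -> z != block_rank j ->
    min_vertex (nth set0 polys z) < j < max_vertex (nth set0 polys z) ->
    if t j then left_of t (nth set0 polys z) (porbit x j)
    else left_of t (porbit x j) (nth set0 polys z).
  move=> hz zj; have zs : z < size polys.
    by apply: leq_ltn_trans (block_rank_lt i); case/andP: hz.
  have zp : nth set0 polys z \in porbits x by rewrite -hm mem_nth.
  have jp : porbit x j \in porbits x by apply/imsetP; exists j.
  have ne : nth set0 polys z != porbit x j.
    by rewrite -nth_block_rank nth_uniq ?block_rank_lt //; case: polysP.
  apply: straddle; [exact: uncrossed_porbits|exact: porbits_disjoint| |exact: porbit_id].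
  by case: (porbits_extremes zp).
case: ifP => tj; apply: contraT => h.
  have := npos _ _ h; rewrite /line_lt => /(_ ltac:(by move=> e; rewrite e ltnn in ij)) lij.
  have rij : block_rank i < block_rank j by move: lij ij; clear; lia.
  have [z hz|z hz hs] := chain; first by case/andP: hz; move: rij; clear; lia.
  have zj : z < block_rank j by case/andP: hz; move: rij; clear; lia.
  have := strad z hz _ hs; rewrite tj ltn_eqF // => /(_ isT) l.
  by have := hl z (block_rank j); rewrite zj block_rank_lt nth_block_rank l => /(_ isT).
have := npos _ _ h; rewrite /line_lt => /(_ ltac:(by move=> e; rewrite e ltnn in jk)) ljk.
have rjk : block_rank j < block_rank k by move: ljk jk; clear; lia.
have [z hz|z hz hs] := chain; first by case/andP: hz; move: rjk; clear; lia.
have zj : block_rank j < z by case/andP: hz; move: rjk; clear; lia.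
have := strad z hz _ hs; rewrite tj gtn_eqF // => /(_ isT) l.
have := hl (block_rank j) z; rewrite zj nth_block_rank l /= => /(_ _); apply.
by apply: leq_ltn_trans (block_rank_lt i); case/andP: hz.
Qed.

End PolygonOrder.

Lemma descents_inverted n (w w' : 'S_n.+1) :
  (forall i j, same_run w i j -> same_run w' i j) ->
  forall p, p \in descents w -> pos w' (nat_app w p) < pos w' (nat_app w p.+1).
Proof.
move=> h p pd; have := pd; rewrite mem_descents => /andP [pn lt].
have r : same_run w (w (inord p.+1)) (w (inord p)).
  rewrite /same_run !pos_perm !inordK //; last exact: ltnW.
  by move=> k hk; have -> : k = p by lia.
exact: same_run_lt (h _ _ r) lt.
Qed.

Theorem theorem6p3 (R : realFieldType) (n : nat) (hn : 1 <= n)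
    (c : 'S_n.+1) (hc : standard_coxeter c)
    (cw : seq 'S_n.+1) (hcw : reduced_word cw c)
    (pt : 'I_n.+1 -> R * R) (hpt : circle_placement c pt) :
  (forall x : 'S_n.+1, x \in NC c ->
     sortable cw (Sc pt x) /\ Read cw (Sc pt x) = x) /\
  (forall w : 'S_n.+1, sortable cw w ->
     Read cw w \in NC c /\ Sc pt (Read cw w) = w).
Proof.
have [cu cuP cwE] := coxeter_word hc hcw; have [_ cE _] := hcw; subst cw.
have cu_mem m : m < n -> m \in cu by move=> mn; rewrite (perm_mem cuP) mem_iota.
have key_inj := @label_key_inj n cu.
have succ := coxeter_successor hn cuP; rewrite cE in succ.
have NCc := NC_clockwise hn key_inj succ.
case: hpt => o [r [_ circle _ height side]].
have side' (i : 'I_n.+1) : 0 < i < n ->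
    if tau cu i then (o.1 < (pt i).1)%R else ((pt i).1 < o.1)%R.
  move=> /andP [i0 ltin]; have i0' : i != ord0 by rewrite -val_eqE -lt0n.
  have imax : i != ord_max by rewrite -val_eqE /= ltn_eqF.
  have [sR sL] := side i i0' imax; case: ifP => ti.
    by apply: sR; rewrite -cE; exact: tau_Rc.
  by apply: sL; rewrite -cE; apply: tau_Lc => //; rewrite ti.
have unc (x : 'S_n.+1) : clockwise_nc (label_key cu) x -> forall P Q, P \in porbits x ->
  Q \in porbits x ->
    P != Q -> uncrossed (tau cu) P Q.
  move=> hx P Q hP hQ PQ a b a' b' aP bQ aP' bQ' aa' h1; apply/negP => h2.
  rewrite (mem_porbits_eq hP aP) in aP' PQ; rewrite (mem_porbits_eq hQ bQ) in bQ' PQ.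
  have := noncrossing key_inj hx aa' h1 h2 aP' bQ'.
  by rewrite -eq_porbit_mem eq_sym (negPf PQ).
have sl (x : 'S_n.+1) : clockwise_nc (label_key cu) x -> forall P Q, P \in porbits x ->
  Q \in porbits x ->
    P != Q -> strictly_left pt P Q <-> left_of (tau cu) P Q.
  move=> hx P Q hP hQ PQ; have QP : Q != P by rewrite eq_sym.
  have [mP _] := porbits_extremes hP; have [mQ _] := porbits_extremes hQ.
  apply: (strictly_leftP circle height side') => //; first exact: porbits_disjoint hP hQ PQ.
    exact: unc hx _ _ hP hQ PQ.
  exact: unc hx _ _ hQ hP QP.
have al (x : 'S_n.+1) : clockwise_nc (label_key cu) x -> aligned cu (Sc pt x).
  by move=> hx; apply: (Sc_aligned (unc x hx) (sl x hx)).
have run (x : 'S_n.+1) : clockwise_nc (label_key cu) x -> forall i j,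
  same_run (Sc pt x) i j <-> j \in porbit x i.
  by move=> hx; exact: (same_run_Sc (sl x hx)).
have sortP (w : 'S_n.+1) : sortable (map (adj_tperm n) cu) w <-> aligned cu w.
  by have [v [_ _ h _]] := sorting_word_aligned hn cuP w.
split=> [x /NCc hx|w /sortP hw].
  split; first by apply/sortP; exact: al.
  apply/permP => i; have [h1 h2] := Read_succ hn cuP (al x hx) i.
  (* Both permutations send [i] to its clockwise successor within the same orbit, the runs being the
     polygons of [x]. *)
  apply: (successor_uniq key_inj (S := porbit x i)); rewrite ?porbit_id //.
  - exact/run.
  - by rewrite porbit_step porbit_id.
  - by move=> m /(run x hx) im; exact: h2.
  - by move=> m im; exact: clockwise hx im.
have hx := Read_clockwise_nc hn cuP hw; split; first exact/NCc.
have rE i j : same_run (Sc pt (Read (map (adj_tperm n) cu) w)) i j <-> same_run w i j.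
  by rewrite (run _ hx) (Read_porbit hn cuP hw).
(* Equal runs make each of the two aligned permutations invert the descents of the other. *)
by apply: aligned_eq (al _ hx) hw _ _; apply: descents_inverted => i j /rE.
Qed.
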